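(* Let $a\in\mathbb R\setminus\mathbb Q$ and consider the quasi-triangular quantum group $(\mathbb R,\widehat R_a)$ with $\widehat R_a(\xi,\eta)=e^{2\pi i a\xi\eta}$ for $\xi,\eta\in\widehat{\mathbb R}$. Let $M=\bar\otimes_{n=-\infty}^{-1}(L^\infty(\mathbb T),\int_{\mathbb T})$ be the infinite von Neumann algebraic tensor product with respect to the states given by normalised Lebesgue measure on the circle, with the diagonal action of $\mathbb R$ whose restriction to each tensor factor is rotation, $\alpha(f)(x,\lambda)=f(\lambda e^{2\pi i x})$ $(x\in\mathbb R,\lambda\in\mathbb T, f\in L^\infty(\mathbb T))$. Let $M\overline\boxtimes M$ be the braided tensor product of two copies of $M$ constructed with $\widehat R_a$, and let $\iota^1,\iota^2:M\to M\overline\boxtimes M$ be the canonical embeddings of the first and second copy. Then there are bounded normal functionals $\rho,\nu\in M_*$ such that there is no $\kappa\in(M\overline\boxtimes M)^*$ with $\kappa(\iota^1(x)\iota^2(y))=\rho(x)\nu(y)$ for all $x,y\in M$.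
   Context: $\mathbb R$ is viewed as a classical locally compact (quantum) group: $L^\infty(\mathbb R)$ with $\Delta(f)(x,y)=f(x+y)$; an action of $\mathbb R$ on a von Neumann algebra $M$ is encoded by $\alpha^M:M\to L^\infty(\mathbb R)\bar\otimes M$ (a normal injective unital $*$-homomorphism with $(\Delta\otimes\mathrm{id})\alpha^M=(\mathrm{id}\otimes\alpha^M)\alpha^M$). The dual $\widehat{\mathbb R}$ is identified with $\mathbb R$ via $\langle\xi,x\rangle=e^{2\pi i\xi x}$; $L^\infty(\widehat{\mathbb R})=\mathrm{vN}(\mathbb R)\subseteq B(L^2(\mathbb R))$ where, via the Fourier transform $\mathcal F(f)(\xi)=\int\overline{\langle\xi,x\rangle}f(x)\,dx$, the translation operator $\lambda_x$ corresponds to the function $\overline{\langle\cdot,x\rangle}$. The function $\widehat R_a\in L^\infty(\widehat{\mathbb R})\bar\otimes L^\infty(\widehat{\mathbb R})$ is a unitary bicharacter, i.e. $(\Delta_{\widehat{\mathbb R}}\otimes\mathrm{id})\widehat R_a=(\widehat R_a)_{[13]}(\widehat R_a)_{[23]}$ and $(\mathrm{id}\otimes\Delta_{\widehat{\mathbb R}})\widehat R_a=(\widehat R_a)_{[13]}(\widehat R_a)_{[12]}$, and an $R$-matrix. The diagonal action $\alpha^M:M\to L^\infty(\mathbb R)\bar\otimes M$ is the unique action for which the embedding of $L^\infty(\mathbb T)$ (with rotation action) onto each tensor factor of $M$ is equivariant. Braided tensor product (specialised to this case): let $W^{\mathbb R}\in L^\infty(\mathbb R)\bar\otimes L^\infty(\widehat{\mathbb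 R})$ be the Kac–Takesaki operator, $(W^{\mathbb R*}h)(x,y)=h(x,x+y)$, so $W^{\mathbb R*}(1\otimes f)W^{\mathbb R}=\Delta(f)$. Represent $M\subseteq B(\mathsf H_M)$ and choose a representation $U^M=(\mathrm{id}\otimes\phi_M)(W^{\mathbb R})$ of $\mathbb R$ on $\mathsf H_M$, $\phi_M:C_0(\widehat{\mathbb R})\to B(\mathsf H_M)$ a non-degenerate $*$-homomorphism, implementing the action: $\alpha^M(m)=U^{M*}(1\otimes m)U^M$. Then on $\mathsf H_M\otimes\mathsf H_M$ put $\iota^1(x)=(\phi_M\otimes\phi_M)(\widehat R_a)(x\otimes1)(\phi_M\otimes\phi_M)(\widehat R_a)^*$, $\iota^2(y)=1\otimes y$, and $M\overline\boxtimes M=\overline{\mathrm{span}}^{\sigma\text{-wot}}\{\iota^1(x)\iota^2(y)\mid x,y\in M\}$. This is a von Neumann algebra, independent of choices up to an isomorphism respecting $\iota^1,\iota^2$. $(M\overline\boxtimes M)^*$ is the full Banach space dual (functionals not assumed normal). *)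

(* Defs.v *)
From HB Require Import structures.
From mathcomp Require Import all_boot all_order all_algebra.
From mathcomp Require Import complex.
From mathcomp Require Import all_classical all_reals all_analysis.
Set Implicit Arguments.
Unset Strict Implicit.
Unset Printing Implicit Defensive.
Import Order.TTheory GRing.Theory Num.Theory.
Import numFieldNormedType.Exports.
Local Open Scope classical_set_scope.
Local Open Scope ring_scope.

(* The complex numbers over R, packed as a numClosedFieldType so that the
   topology and normed-module structures of number fields are found on it;
   norms of complex normed modules are (nonnegative, real) elements of it. *)
Definition Cplx (R : realType) : numClosedFieldType := R[i].

Definition toC (R : realType) (r : R) : Cplx R := Complex r 0.
Definition Rpart (R : realType) (z : Cplx R) : R := complex.Re z.
Definition Ipart (R : realType) (z : Cplx R) : R := complex.Im z.

Definition expi (R : realType) (t : R) : Cplx R :=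
  Complex (cos (2 * pi * t)) (sin (2 * pi * t)).

(* The inner product is linear in the first variable, antilinear in the
   second. *)
Record hilbert (R : realType) := Hilbert {
  hcar :> completeNormedModType (Cplx R) ;
  hdot : {dot hcar for Num.conj} ;
  hdotE : forall v : hcar, `|v| ^+ 2 = hdot v v }.
Arguments hdot {R h}.

Definition lspan (K : numFieldType) (V : lmodType K) (S : set V) : set V :=
  [set u | exists n (c : 'I_n -> K) (w : 'I_n -> V),
     (forall i, S (w i)) /\ u = \sum_(i < n) c i *: w i].

Definition total (R : realType) (H : hilbert R) (S : set H) :=
  closure (lspan S) = setT.

Definition bounded_op (R : realType) (H : hilbert R) : set (H -> H) :=
  [set T | linear T /\ continuous T].

Definition is_adjoint (R : realType) (H : hilbert R) (S T : H -> H) :=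
  forall v w, hdot (S v) w = hdot v (T w).

Definition commutant (R : realType) (H : hilbert R) (S : set (H -> H)) :
    set (H -> H) :=
  [set T | bounded_op T /\ forall X, S X -> T \o X = X \o T].

(* The predual A_* of a space A of operators: the restrictions to A of the
   sigma-weakly continuous functionals T |-> \sum_n <T xi_n, eta_n>.  Values of
   omega outside A are irrelevant. *)
Definition normal_functional (R : realType) (H : hilbert R) (A : set (H -> H))
    (omega : (H -> H) -> Cplx R) :=
  exists xi eta : nat -> H,
    [/\ cvgn (series (fun n => `|xi n| ^+ 2)),
        cvgn (series (fun n => `|eta n| ^+ 2)) &
        forall T, A T ->
          series (fun n => hdot (T (xi n)) (eta n)) @ \oo --> omega T].

(* The closure of A in B(H) for the sigma-weak operator topology. *)
Definition sigma_wot_closure (R : realType) (H : hilbert R)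
    (A : set (H -> H)) : set (H -> H) :=
  [set T | bounded_op T /\
     forall n (omega : 'I_n -> (H -> H) -> Cplx R) (e : R), 0 < e ->
       (forall i, normal_functional (@bounded_op R H) (omega i)) ->
       exists2 S, A S & forall i, `|omega i T - omega i S| < toC e].

(* The Banach space dual A^* of a linear space A of bounded operators: linear
   functionals kappa on A with |kappa T| <= c * |T| for some c, where b below
   ranges over the upper bounds of the operator norm |T|. *)
Definition bounded_functional (R : realType) (H : hilbert R)
    (A : set (H -> H)) (kappa : (H -> H) -> Cplx R) :=
  (forall (z : Cplx R) S T, A S -> A T ->
     kappa (z *: S + T) = z * kappa S + kappa T) /\
  exists c : R, forall T (b : R), A T ->
     (forall v, `|T v| <= toC b * `|v|) -> `|kappa T| <= toC (c * b).

(* A is meant to be a *-algebra of functions for the pointwise operations, with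
   involution the pointwise conjugation. *)
Record star_rep (R : realType) (X : Type) (A : set (X -> Cplx R))
    (H : hilbert R) (r : (X -> Cplx R) -> (H -> H)) : Prop := StarRep {
  star_rep_bounded : forall f, A f -> bounded_op (r f) ;
  star_rep_linear : forall (z : Cplx R) f g, A f -> A g ->
    r (fun x => z * f x + g x) = z *: r f + r g ;
  star_rep_mul : forall f g, A f -> A g ->
    r (fun x => f x * g x) = r f \o r g ;
  star_rep_adj : forall f, A f ->
    is_adjoint (r f) (r (fun x => Num.conj (f x))) }.

(* Functions on the circle T = {|lambda| = 1} are represented by functions on
   the complex plane of which only the values on T matter; T carries the image
   of the Lebesgue measure of [0, 1] under t |-> e^{2 pi i t}. *)
Definition Linfty_circle (R : realType) : set (Cplx R -> Cplx R) :=
  [set f | [/\ measurable_fun setT (fun t : R => Rpart (f (expi t))),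
               measurable_fun setT (fun t : R => Ipart (f (expi t))) &
               exists c : R, {ae (@lebesgue_measure R), forall t,
                                `|f (expi t)| <= toC c}]].

Definition circle_ae_eq (R : realType) (f g : Cplx R -> Cplx R) :=
  {ae (@lebesgue_measure R), forall t, f (expi t) = g (expi t)}.

Definition circle_int (R : realType) (f : Cplx R -> Cplx R) : Cplx R :=
  Complex (\int[@lebesgue_measure R]_(t in `[0, 1]) Rpart (f (expi t)))
          (\int[@lebesgue_measure R]_(t in `[0, 1]) Ipart (f (expi t))).

Definition elementary_tensor (R : realType) (I : choiceType) (H : hilbert R)
    (j : I -> (Cplx R -> Cplx R) -> (H -> H)) (s : seq I)
    (f : I -> Cplx R -> Cplx R) : H -> H :=
  \big[(fun S T : H -> H => S \o T)/id]_(i <- s) j i (f i).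

(* (H, Omega, j) is the representation on \bigotimes_{i in I} (L^2(T), 1) of
   the algebraic tensor product of copies of L^oo(T) indexed by I, i.e. the GNS
   representation of the product of the states given by Lebesgue measure; j i
   is the embedding of the i-th factor.  These properties determine (H, Omega,
   j) up to unitary equivalence; in particular every j i is normal and vanishes
   only on null functions. *)
Record product_state_gns (R : realType) (I : choiceType) (H : hilbert R)
    (Omega : H) (j : I -> (Cplx R -> Cplx R) -> (H -> H)) : Prop :=
  ProductStateGNS {
  gns_rep : forall i, star_rep (@Linfty_circle R) (j i) ;
  gns_unital : forall i, j i (fun=> 1) = id ;
  gns_ae : forall i f g, Linfty_circle f -> Linfty_circle g ->
    circle_ae_eq f g -> j i f = j i g ;
  gns_comm : forall i k f g, i != k -> Linfty_circle f -> Linfty_circle g ->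
    j i f \o j k g = j k g \o j i f ;
  gns_state : forall s f, uniq s -> (forall i, Linfty_circle (f i)) ->
    hdot (elementary_tensor j s f Omega) Omega =
    \prod_(i <- s) circle_int (f i) ;
  gns_cyclic : total [set v | exists s f,
    [/\ uniq s, forall i, Linfty_circle (f i) &
        v = elementary_tensor j s f Omega]] }.

(* The von Neumann algebra \bar\otimes_{i in I} (L^oo(T), \int_T): the one
   generated by the GNS representation of the product state. *)
Definition inf_tensor (R : realType) (I : choiceType) (H : hilbert R)
    (j : I -> (Cplx R -> Cplx R) -> (H -> H)) : set (H -> H) :=
  commutant (commutant [set T | exists i f, Linfty_circle f /\ T = j i f]).

Record normal_star_hom (R : realType) (H1 H2 : hilbert R)
    (M : set (H1 -> H1)) (r : (H1 -> H1) -> (H2 -> H2)) : Prop :=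
  NormalStarHom {
  hom_bounded : forall x, M x -> bounded_op (r x) ;
  hom_linear : forall (z : Cplx R) x y, M x -> M y ->
    r (z *: x + y) = z *: r x + r y ;
  hom_mul : forall x y, M x -> M y -> r (x \o y) = r x \o r y ;
  hom_adj : forall x y, M x -> M y -> is_adjoint x y ->
    is_adjoint (r x) (r y) ;
  hom_unital : r id = id ;
  hom_normal : forall omega, normal_functional (r @` M) omega ->
    normal_functional M (omega \o r) }.

Definition faithful_normal_rep (R : realType) (H1 H2 : hilbert R)
    (M : set (H1 -> H1)) (r : (H1 -> H1) -> (H2 -> H2)) :=
  normal_star_hom M r /\ (forall x y, M x -> M y -> r x = r y -> x = y).

(* An action of the group R on M; the map alpha^M from M to the von Neumann
   tensor product of L^oo(R) with M is m |-> (x |-> alpha x m). *)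
Record action (R : realType) (H : hilbert R) (M : set (H -> H))
    (alpha : R -> (H -> H) -> (H -> H)) : Prop := Action {
  action_stable : forall x m, M m -> M (alpha x m) ;
  action_hom : forall x, normal_star_hom M (alpha x) ;
  action0 : forall m, M m -> alpha 0 m = m ;
  actionD : forall x y m, M m -> alpha (x + y) m = alpha x (alpha y m) ;
  action_continuous : forall omega m, normal_functional M omega -> M m ->
    continuous (fun x : R => omega (alpha x m)) }.

Definition rotate (R : realType) (x : R) (f : Cplx R -> Cplx R) :
    Cplx R -> Cplx R :=
  fun lambda => f (lambda * expi x).

Definition diagonal_action (R : realType) (I : choiceType) (H : hilbert R)
    (j : I -> (Cplx R -> Cplx R) -> (H -> H))
    (alpha : R -> (H -> H) -> (H -> H)) :=
  action (inf_tensor j) alpha /\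
  forall x i f, Linfty_circle f -> alpha x (j i f) = j i (rotate x f).

Definition C0 (R : realType) (X : topologicalType) : set (X -> Cplx R) :=
  [set f | continuous f /\
     forall e : R, 0 < e ->
       exists2 K, compact K & forall x, ~ K x -> `|f x| < toC e].

Definition nondegenerate_rep (R : realType) (X : topologicalType)
    (H : hilbert R) (phi : (X -> Cplx R) -> (H -> H)) :=
  star_rep (@C0 R X) phi /\
  total [set w | exists f v, C0 f /\ w = phi f v].

(* T is the value at the bounded continuous function b of the extension of phi
   to the multiplier algebra of C_0(X). *)
Definition multiplier_value (R : realType) (X : topologicalType)
    (H : hilbert R) (phi : (X -> Cplx R) -> (H -> H)) (b : X -> Cplx R)
    (T : H -> H) :=
  bounded_op T /\ forall f, C0 f -> T \o phi f = phi (fun x => b x * f x).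

Definition pairing (R : realType) (xi x : R) : Cplx R := expi (xi * x).

(* The representation U = (id (x) phi)(W) of the real line, x |-> U x.  Since
   W is the function x |-> lambda_x, and lambda_x is the function
   xi |-> conj <xi, x> on the dual group, U x = phi(conj <., x>). *)
Definition rep_of_C0 (R : realType) (H : hilbert R)
    (phi : (R -> Cplx R) -> (H -> H)) (U : R -> H -> H) :=
  forall x, multiplier_value phi (fun xi => Num.conj (pairing xi x)) (U x).

(* alpha^M(m) = U^* (1 (x) m) U, evaluated at every point of the real line. *)
Definition implements (R : realType) (H1 H2 : hilbert R) (M : set (H1 -> H1))
    (alpha : R -> (H1 -> H1) -> (H1 -> H1)) (r : (H1 -> H1) -> (H2 -> H2))
    (U : R -> H2 -> H2) :=
  forall x m, M m -> exists2 V, bounded_op V /\ is_adjoint (U x) V &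
    r (alpha x m) = V \o r m \o U x.

Definition hilbert_tensor (R : realType) (H K : hilbert R)
    (tens : H -> H -> K) :=
  (forall v w v' w',
     hdot (tens v w) (tens v' w') = hdot v v' * hdot w w') /\
  total [set u | exists v w, u = tens v w].

Definition tensor_op (R : realType) (H K : hilbert R) (tens : H -> H -> K)
    (S T : H -> H) (X : K -> K) :=
  bounded_op X /\ forall v w, X (tens v w) = tens (S v) (T w).

(* phi2 is phi (x) phi on C_0(R^2) = C_0(R) (x) C_0(R); it is determined by its
   values on the functions (x, y) |-> f x * g y. *)
Definition tensor_rep (R : realType) (H K : hilbert R) (tens : H -> H -> K)
    (phi : (R -> Cplx R) -> (H -> H)) (phi2 : (R * R -> Cplx R) -> (K -> K)) :=
  star_rep (@C0 R (R * R)%type) phi2 /\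
  forall f g, C0 f -> C0 g ->
    tensor_op tens (phi f) (phi g) (phi2 (fun p => f p.1 * g p.2)).

Definition Rhat (R : realType) (a : R) (p : R * R) : Cplx R :=
  expi (a * p.1 * p.2).

(* iota^1(x) = Rop (x (x) 1) Rop^* and iota^2(y) = 1 (x) y, where M acts
   through its representation r. *)
Record braided_embeddings (R : realType) (H1 H K : hilbert R)
    (M : set (H1 -> H1)) (r : (H1 -> H1) -> (H -> H)) (tens : H -> H -> K)
    (Rop : K -> K) (iota1 iota2 : (H1 -> H1) -> (K -> K)) : Prop :=
  BraidedEmbeddings {
  braided_left : forall x, M x -> exists X Rst,
    [/\ tensor_op tens (r x) id X, bounded_op Rst /\ is_adjoint Rop Rst &
        iota1 x = Rop \o X \o Rst] ;
  braided_right : forall y, M y -> tensor_op tens id (r y) (iota2 y) }.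

Definition braided_product (R : realType) (H1 K : hilbert R)
    (M : set (H1 -> H1)) (iota1 iota2 : (H1 -> H1) -> (K -> K)) :
    set (K -> K) :=
  sigma_wot_closure (lspan [set T | exists x y,
    [/\ M x, M y & T = iota1 x \o iota2 y]]).

(* Main.v *)
(* Let u be the coordinate function of one tensor factor. Conjugation by r(u^k)
   shifts the spectrum of phi by k, and Rhat(xi + k, eta) is
   e^(2 pi i k a eta) Rhat(xi, eta); hence iota1(u^k) = r(u^k) (x) U_(-ka).
   As a is irrational, there is an arc whose rotates by ka, k < N, are pairwise
   disjoint. If p is its indicator function, the operators iota1(u^k) iota2(p),
   k < N, have orthogonal ranges, so N^(-1/2) sum_(k < N) iota1(u^k) iota2(p) is
   a contraction. Take N_n = 32^(2n). With Fejer vectors of order 2 N_n one builds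
   rho = sum_n 4^(-n) <. xi_n, xi_n> with rho(u^k) >= 4^(-n)/2 for k < N_n, and with
   vectors carried by the arcs p_n one builds nu with nu(p_n) >= 4^(-n). Then kappa
   is at least 32^n 4^(-n)/2 4^(-n) = 2^n/2 on the n-th contraction. *)
Require Import Defs.
From HB Require Import structures.
From mathcomp Require Import all_boot all_order all_algebra.
From mathcomp Require Import complex.
From mathcomp Require Import all_classical all_reals all_analysis.
From mathcomp Require Import ring lra.
Set Implicit Arguments.
Unset Strict Implicit.
Unset Printing Implicit Defensive.
Import Order.TTheory GRing.Theory Num.Theory.
Import numFieldNormedType.Exports.
Local Open Scope classical_set_scope.
Local Open Scope ring_scope.

(** * Complex numbers and Hilbert spaces *)

(** The costly step is the formula for iota1(u^k). [Rop] is known only as a multiplier of [phi2] on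
    C_0(R^2), so Rhat cannot simply be shifted under a spectral integral. What the hypotheses give
    is the commutation of w = r(u^k) with every U_x, that is, with the characters of xi. The
    relation phi2(b) (w (x) 1) = (w (x) 1) phi2(b(. + k, .)) is therefore proved for characters of
    xi and for bounded continuous functions of eta, carried over sums and products, and extended to
    Rhat by limits that are uniformly bounded and uniform on squares. The arcs are what makes the
    norm small: without p the sum of the N unitaries iota1(u^k) has norm N. With p, distinct terms
    have orthogonal ranges and |iota1(u^k) iota2(p) x| = |iota2(p) x| for every k, so the sum has
    norm at most N^(1/2). Omega itself is useless for rho, because <u^k Omega, Omega> = 0 for k > 0.
    A normalised sum of consecutive u^a Omega overlaps with its translates. As kappa need not be
    normal, it is evaluated on finite combinations only. *)

Section ComplexNumbers.
Variable R : realType.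
Implicit Types (x y : R) (z w : Cplx R).

Lemma CplxP z w : Rpart z = Rpart w -> Ipart z = Ipart w -> z = w.
Proof. by case: z w => [a b] [c d] /= -> ->. Qed.

Lemma RpartD z w : Rpart (z + w) = Rpart z + Rpart w.
Proof. by case: z w => [a b] [c d]. Qed.
Lemma IpartD z w : Ipart (z + w) = Ipart z + Ipart w.
Proof. by case: z w => [a b] [c d]. Qed.
Lemma RpartN z : Rpart (- z) = - Rpart z.
Proof. by case: z => a b. Qed.
Lemma IpartN z : Ipart (- z) = - Ipart z.
Proof. by case: z => a b. Qed.
Lemma RpartM z w : Rpart (z * w) = Rpart z * Rpart w - Ipart z * Ipart w.
Proof. by case: z w => [a b] [c d]. Qed.
Lemma IpartM z w : Ipart (z * w) = Rpart z * Ipart w + Ipart z * Rpart w.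
Proof. by case: z w => [a b] [c d]. Qed.
Lemma Rpart_conj z : Rpart (Num.conj z) = Rpart z.
Proof. by case: z => [a b]. Qed.
Lemma Ipart_conj z : Ipart (Num.conj z) = - Ipart z.
Proof. by case: z => [a b]. Qed.
Lemma toC1 : toC 1 = 1 :> Cplx R. Proof. by []. Qed.
Lemma toC0 : toC 0 = 0 :> Cplx R. Proof. by []. Qed.
Lemma toCD x y : toC (x + y) = toC x + toC y.
Proof. exact: (rmorphD (@real_complex R)). Qed.
Lemma toCN x : toC (- x) = - toC x.
Proof. exact: (rmorphN (@real_complex R)). Qed.
Lemma toCM x y : toC (x * y) = toC x * toC y.
Proof. exact: (rmorphM (@real_complex R)). Qed.
Lemma toCX x n : toC (x ^+ n) = toC x ^+ n.
Proof. exact: (rmorphXn (@real_complex R)). Qed.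
Lemma toC_nat n : toC n%:R = n%:R :> Cplx R.
Proof. exact: (rmorph_nat (@real_complex R)). Qed.
Lemma toC_inj : injective (@toC R).
Proof. by move=> x y []. Qed.
Lemma toC_le x y : (toC x <= toC y) = (x <= y).
Proof. exact: lecR. Qed.
Lemma toC_lt x y : (toC x < toC y) = (x < y).
Proof. exact: ltcR. Qed.
Lemma conj_toC x : Num.conj (toC x) = toC x.
Proof. by apply: CplxP; rewrite ?Rpart_conj ?Ipart_conj //= oppr0. Qed.


Lemma normCplxE z : `|z| = toC (Num.sqrt (Rpart z ^+ 2 + Ipart z ^+ 2)).
Proof. exact: normc_def. Qed.

Lemma norm_toC x : `|toC x| = toC `|x|.
Proof. by rewrite normCplxE /= expr0n addr0 sqrtr_sqr. Qed.

Lemma sqr_normCplx z : `|z| ^+ 2 = toC (Rpart z ^+ 2 + Ipart z ^+ 2).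
Proof. by rewrite normCplxE -toCX sqr_sqrtr // addr_ge0 ?sqr_ge0. Qed.

Lemma Rpart_le_norm z : toC `|Rpart z| <= `|z|.
Proof. exact: normc_ge_Re. Qed.

Lemma Ipart_le_norm z : toC `|Ipart z| <= `|z|.
Proof.
rewrite normCplxE toC_le -sqrtr_sqr ler_wsqrtr //.
by rewrite lerDr sqr_ge0.
Qed.

Lemma norm_le_RI z : `|z| <= toC (`|Rpart z| + `|Ipart z|).
Proof.
rewrite -(ler_pXn2r (n := 2)) ?nnegrE //; last first.
  by rewrite -toC0 toC_le addr_ge0.
rewrite sqr_normCplx -toCX toC_le sqrrD !real_normK ?num_real //.
by rewrite lerD2r lerDl mulrn_wge0 // mulr_ge0.
Qed.

Lemma ge0_toC z : 0 <= z -> z = toC (Rpart z).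
Proof. by case: z => a b; rewrite lecE /= => /andP[/eqP -> _]. Qed.

Lemma gt0_toC z : 0 < z -> exists2 x, 0 < x & z = toC x.
Proof.
case: z => a b; rewrite ltcE /= => /andP[/eqP -> a0].
by exists a.
Qed.

Lemma norm_toC_Rpart z : `|z| = toC (Rpart `|z|).
Proof. exact: ge0_toC. Qed.
End ComplexNumbers.

Section ComplexTopology.
Variable R : realType.

Lemma cvg_Complex (T : Type) (F : set_system T) (FF : Filter F)
    (f g : T -> R) (x y : R) :
  f @ F --> x -> g @ F --> y ->
  (fun t => Complex (f t) (g t) : Cplx R) @ F --> (Complex x y : Cplx R).
Proof.
move=> /cvgrPdist_lt fx /cvgrPdist_lt gy; apply/cvgrPdist_lt => _ /gt0_toC[e e0 ->].
near=> t; apply: le_lt_trans (norm_le_RI _) _; rewrite toC_lt /= (splitr e).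
by apply: ltrD; near: t; [apply: fx|apply: gy]; rewrite divr_gt0.
Unshelve. all: by end_near. Qed.

Lemma cvg_Rpart (T : Type) (F : set_system T) (FF : Filter F)
    (f : T -> Cplx R) (z : Cplx R) :
  f @ F --> z -> (fun t => Rpart (f t)) @ F --> Rpart z.
Proof.
move=> /cvgrPdist_lt fz; apply/cvgrPdist_lt => e e0.
have := fz (toC e); rewrite -toC0 toC_lt => /(_ e0).
apply: filterS => t; rewrite -toC_lt; apply: le_lt_trans.
by rewrite -RpartN -RpartD; exact: Rpart_le_norm.
Qed.

Lemma cvg_Ipart (T : Type) (F : set_system T) (FF : Filter F)
    (f : T -> Cplx R) (z : Cplx R) :
  f @ F --> z -> (fun t => Ipart (f t)) @ F --> Ipart z.
Proof.
move=> /cvgrPdist_lt fz; apply/cvgrPdist_lt => e e0.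
have := fz (toC e); rewrite -toC0 toC_lt => /(_ e0).
apply: filterS => t; rewrite -toC_lt; apply: le_lt_trans.
by rewrite -IpartN -IpartD; exact: Ipart_le_norm.
Qed.

End ComplexTopology.

Section Hilbert.
Variable R : realType.

Section InnerProduct.
Variable H : hilbert R.
Implicit Types u v w : H.

Lemma hdotDl u v w : hdot (u + v) w = hdot u w + hdot v w.
Proof. exact: linearDl. Qed.
Lemma hdotDr u v w : hdot u (v + w) = hdot u v + hdot u w.
Proof. exact: linearDr. Qed.
Lemma hdotBl u v w : hdot (u - v) w = hdot u w - hdot v w.
Proof. exact: linearBl. Qed.
Lemma hdotBr u v w : hdot u (v - w) = hdot u v - hdot u w.
Proof. exact: linearBr. Qed.
Lemma hdot0l u : hdot 0 u = 0.
Proof. exact: linear0l. Qed.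
Lemma hdot0r u : hdot u 0 = 0.
Proof. exact: linear0r. Qed.
Lemma hdotZl (z : Cplx R) u v : hdot (z *: u) v = z * hdot u v.
Proof. exact: linearZl_LR. Qed.
Lemma hdotZr (z : Cplx R) u v : hdot u (z *: v) = Num.conj z * hdot u v.
Proof. exact: linearZr_LR. Qed.
Lemma hdotC u v : hdot u v = Num.conj (hdot v u).
Proof. by rewrite (hermC hdot u v) expr0 mul1r. Qed.
Lemma hdot_suml I (r : seq I) (P : pred I) (F : I -> H) u :
  hdot (\sum_(i <- r | P i) F i) u = \sum_(i <- r | P i) hdot (F i) u.
Proof. exact: linear_sumlz. Qed.
Lemma hdot_sumr I (r : seq I) (P : pred I) (F : I -> H) u :
  hdot u (\sum_(i <- r | P i) F i) = \sum_(i <- r | P i) hdot u (F i).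
Proof. exact: linear_sumr. Qed.

Lemma hdot_norm_eq0 u : hdot u u = 0 -> u = 0.
Proof.
by rewrite -hdotE => /eqP; rewrite expf_eq0 /= normr_eq0 => /eqP.
Qed.

Lemma Cauchy_Schwarz u v : `|hdot u v| <= `|u| * `|v|.
Proof.
have [->|v0] := eqVneq v 0; first by rewrite hdot0r normr0 mulr_ge0.
have v2 : 0 < hdot v v by rewrite -hdotE exprn_gt0 // normr_gt0.
pose c := hdot u v / hdot v v.
have : 0 <= hdot (u - c *: v) (u - c *: v) by rewrite -hdotE exprn_ge0.
have cv : hdot (u - c *: v) v = 0.
  by rewrite hdotBl hdotZl /c mulfVK ?subrr // gt_eqF.
rewrite hdotBr hdotZr cv mulr0 subr0 hdotBl hdotZl (hdotC v u) subr_ge0 /c.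
rewrite mulrAC -normCK ler_pdivrMr // -!hdotE -exprMn.
by rewrite ler_pXn2r ?nnegrE ?mulr_ge0.
Qed.
End InnerProduct.

Lemma closure_sub (T : topologicalType) (A B : set T) :
  closed B -> A `<=` B -> closure A `<=` B.
Proof. by move=> /closure_id Bc AB; rewrite Bc; exact: closure_subset. Qed.

Section LinearMaps.
Variables (V W : lmodType (Cplx R)) (f : V -> W).
Hypothesis lf : linear f.

Lemma linear_map0 : f 0 = 0.
Proof. by have := lf (-1) 0 0; rewrite scaler0 addr0 scaleN1r addNr. Qed.

Lemma linear_mapD u v : f (u + v) = f u + f v.
Proof. by have := lf 1 u v; rewrite !scale1r. Qed.

Lemma linear_mapZ z u : f (z *: u) = z *: f u.
Proof. by have := lf z u 0; rewrite linear_map0 !addr0. Qed.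

Lemma linear_mapB u v : f (u - v) = f u - f v.
Proof. by rewrite linear_mapD -scaleN1r linear_mapZ scaleN1r. Qed.

Lemma linear_map_sum I (r : seq I) (P : pred I) (F : I -> V) :
  f (\sum_(i <- r | P i) F i) = \sum_(i <- r | P i) f (F i).
Proof. by apply: big_morph; [exact: linear_mapD|exact: linear_map0]. Qed.
End LinearMaps.

Lemma lspan_linear0 (H : hilbert R) (K : normedModType (Cplx R)) (S : set H) (f : H -> K) :
  linear f -> (forall v, S v -> f v = 0) -> forall v, lspan S v -> f v = 0.
Proof.
move=> lf fS v [n [c [w [Sw ->]]]].
rewrite (linear_map_sum lf) big1 // => i _.
by rewrite (linear_mapZ lf) fS ?scaler0.
Qed.

Lemma total_eq0 (H : hilbert R) (K : normedModType (Cplx R)) (S : set H) (f : H -> K) :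
  Defs.total S -> linear f -> continuous f -> (forall v, S v -> f v = 0) ->
  forall v, f v = 0.
Proof.
move=> tS lf cf fS v; have : closure (lspan S) v by rewrite tS.
apply: (@closure_sub _ (lspan S) (f @^-1` [set 0])); last first.
  exact: lspan_linear0.
apply: closed_comp => [? _|]; first exact: cf.
exact/accessible_closed_set1/hausdorff_accessible/norm_hausdorff.
Qed.

Lemma total_eq (H : hilbert R) (K : normedModType (Cplx R)) (S : set H) (f g : H -> K) :
  Defs.total S -> linear f -> continuous f -> linear g -> continuous g ->
  (forall v, S v -> f v = g v) -> forall v, f v = g v.
Proof.
move=> tS lf cf lg cg fgS v; apply/eqP; rewrite -subr_eq0; apply/eqP.
apply: (@total_eq0 H K S (fun v => f v - g v)) => //.
- by move=> z u w; rewrite lf lg scalerBr opprD addrACA.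
- by move=> x; apply: cvgB; [exact: cf|exact: cg].
- by move=> u /fgS ->; rewrite subrr.
Qed.

Lemma hdot_continuousl (H : hilbert R) (w : H) : continuous (fun v : H => hdot v w).
Proof.
move=> v; apply/cvgrPdist_lt => e e0; near=> u.
rewrite -hdotBl; apply: le_lt_trans (Cauchy_Schwarz _ _) _.
have w1 : 0 < `|w| + 1 by rewrite ltr_wpDl.
apply: (@le_lt_trans _ _ (`|v - u| * (`|w| + 1))).
  by rewrite ler_wpM2l // lerDl.
rewrite -ltr_pdivlMr //; near: u.
by apply: cvgr_dist_lt; [exact: cvg_id|exact: divr_gt0].
Unshelve. all: by end_near. Qed.

Lemma total_orth (H : hilbert R) (S : set H) (w : H) :
  Defs.total S -> (forall v, S v -> hdot v w = 0) -> w = 0.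
Proof.
move=> tS wS; apply: hdot_norm_eq0.
have : closure (lspan S) w by rewrite tS.
apply: (@closure_sub _ (lspan S) [set v | hdot v w = 0]).
  apply: (@closed_comp _ _ (fun v : H => hdot v w) [set 0]).
    by move=> ? _; exact: hdot_continuousl.
  exact/accessible_closed_set1/hausdorff_accessible/norm_hausdorff.
move=> v [n [c [x [Sx ->]]]] /=.
by rewrite hdot_suml big1 // => i _; rewrite hdotZl wS ?mulr0.
Qed.

Lemma total_hdot_eq (H : hilbert R) (S : set H) (u w : H) :
  Defs.total S -> (forall v, S v -> hdot v u = hdot v w) -> u = w.
Proof.
move=> tS uwS; apply/eqP; rewrite -subr_eq0; apply/eqP.
by apply: (total_orth tS) => v /uwS e; rewrite hdotBr e subrr.
Qed.

End Hilbert.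

(** * Representations of C_0(X) and their multipliers *)

Section C0Functions.
Variables (R : realType) (X : topologicalType).
Implicit Types f g b : X -> Cplx R.

(** These functions multiply C_0(X) into itself ([C0_mul]), so they are the b for which
    [multiplier_value phi b] is meaningful. *)
Definition bounded_continuous_fun b :=
  continuous b /\ exists c : R, forall x, `|b x| <= toC c.

Lemma continuous_Complex (f g : X -> R) : continuous f -> continuous g ->
  continuous (fun x => Complex (f x) (g x) : Cplx R).
Proof. by move=> cf cg x; apply: cvg_Complex; [exact: cf|exact: cg]. Qed.

Lemma continuous_conj f : continuous f -> continuous (fun x => Num.conj (f x)).
Proof.
move=> cf; have -> : (fun x => Num.conj (f x)) =
    (fun x => Complex (Rpart (f x)) (- Ipart (f x))).
  by apply/funext => x; apply: CplxP; rewrite ?Rpart_conj ?Ipart_conj.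
move=> x; apply: cvg_Complex; first by apply: cvg_Rpart; exact: cf.
by apply: cvgN; apply: cvg_Ipart; exact: cf.
Qed.

Lemma C0_bounded f : C0 f -> exists2 c : R, 0 < c & forall x, `|f x| <= toC c.
Proof.
move=> [cf f0]; have [K cK Kf] := f0 1 ltr01.
pose h x := Rpart `|f x|.
have ch : continuous h.
  by move=> x; apply: cvg_Rpart; apply: cvg_norm; exact: cf.
have : compact (h @` K).
  by apply: continuous_compact => //; exact: continuous_subspaceT.
move=> /compact_bounded[M [Mr Mh]].
exists (Num.max 1 (M + 1)); first by rewrite lt_max ltr01.
move=> x; rewrite norm_toC_Rpart toC_le le_max.
have [Kx|/Kf] := pselect (K x); last first.
  by rewrite norm_toC_Rpart toC_lt => /ltW ->.
apply/orP; right; apply: le_trans (ler_norm _) _.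
by apply: (Mh (M + 1)); [rewrite ltrDl|exists x].
Qed.

Lemma C0_mul b f : bounded_continuous_fun b -> C0 f -> C0 (fun x => b x * f x).
Proof.
move=> [cb [c bc]] [cf f0]; split.
  by move=> x; apply: cvgM; [exact: cb|exact: cf].
move=> e e0; have c1 : 0 < `|c| + 1 by rewrite ltr_wpDl.
have [K cK Kf] := f0 (e / (`|c| + 1)) (divr_gt0 e0 c1); exists K => // x /Kf.
move=> fx; rewrite normrM.
apply: (@le_lt_trans _ _ (toC (`|c| + 1) * `|f x|)).
  rewrite ler_wpM2r // (le_trans (bc x)) // toC_le.
  by rewrite (le_trans (ler_norm _)) // lerDl.
by rewrite -[e](divfK (lt0r_neq0 c1)) toCM [X in _ < X]mulrC ltr_pM2l // -toC0 toC_lt.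
Qed.

Lemma bcf_C0 f : C0 f -> bounded_continuous_fun f.
Proof. by move=> Cf; split; [case: Cf|case: (C0_bounded Cf) => c _ ?; exists c]. Qed.

Lemma bcf_conj f : bounded_continuous_fun f ->
  bounded_continuous_fun (fun x => Num.conj (f x)).
Proof.
move=> [cf [c fc]]; split; first exact: continuous_conj.
by exists c => x; rewrite norm_conjC.
Qed.

Lemma bcf_mul f g : bounded_continuous_fun f -> bounded_continuous_fun g ->
  bounded_continuous_fun (fun x => f x * g x).
Proof.
move=> [cf [c fc]] [cg [d gd]]; split.
  by move=> x; apply: cvgM; [exact: cf|exact: cg].
exists (c * d) => x; rewrite normrM toCM; apply: ler_pM => //; exact: normr_ge0.
Qed.

Lemma bcf_cst (z : Cplx R) : bounded_continuous_fun (fun _ : X => z).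
Proof.
split; first by move=> x; exact: cvg_cst.
by exists (Rpart `|z|) => _; rewrite -norm_toC_Rpart.
Qed.

Lemma bcf_lin (z : Cplx R) f g : bounded_continuous_fun f ->
  bounded_continuous_fun g -> bounded_continuous_fun (fun x => z * f x + g x).
Proof.
move=> /(bcf_mul (bcf_cst z))[czf [c fc]] [cg [d gd]]; split.
  by move=> x; apply: cvgD; [exact: czf|exact: cg].
by exists (c + d) => x; rewrite toCD (le_trans (ler_normD _ _)) // lerD.
Qed.

Lemma C0_conj f : C0 f -> C0 (fun x => Num.conj (f x)).
Proof.
move=> [cf f0]; split; first exact: continuous_conj.
by move=> e /f0[K cK Kf]; exists K => // x /Kf; rewrite norm_conjC.
Qed.

Lemma C0_add f g : C0 f -> C0 g -> C0 (fun x => f x + g x).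
Proof.
move=> [cf f0] [cg g0]; split.
  by move=> x; apply: cvgD; [exact: cf|exact: cg].
move=> e e0; have e2 : 0 < e / 2 by rewrite divr_gt0.
have [K cK Kf] := f0 _ e2; have [L cL Lg] := g0 _ e2.
exists (K `|` L); first exact: compactU.
move=> x /not_orP[/Kf fx /Lg gx]; apply: le_lt_trans (ler_normD _ _) _.
by rewrite [e]splitr toCD ltrD.
Qed.

Lemma C0_scale (z : Cplx R) f : C0 f -> C0 (fun x => z * f x).
Proof. exact/C0_mul/bcf_cst. Qed.

Lemma C0_lin (z : Cplx R) f g : C0 f -> C0 g -> C0 (fun x => z * f x + g x).
Proof. by move=> Cf Cg; apply: C0_add => //; exact: C0_scale. Qed.

End C0Functions.

Lemma bounded_op_comp (R : realType) (H : hilbert R) (S T : H -> H) :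
  bounded_op S -> bounded_op T -> bounded_op (S \o T).
Proof.
move=> [lS cS] [lT cT]; split; first by move=> z u v /=; rewrite lT lS.
by move=> x; apply: continuous_comp; [exact: cT|exact: cS].
Qed.

Section StarRep.
Variables (R : realType) (X : topologicalType) (H : hilbert R).
Variable phi : (X -> Cplx R) -> (H -> H).
Hypothesis rphi : star_rep (@C0 R X) phi.
Implicit Types f g b : X -> Cplx R.

Lemma C0_zero : C0 (fun _ : X => 0 : Cplx R).
Proof.
split; first by move=> x; exact: cvg_cst.
move=> e e0; exists set0; first exact: compact0.
by move=> x _; rewrite normr0 -toC0 toC_lt.
Qed.

Lemma star_rep_lin (z : Cplx R) f g v : C0 f -> C0 g ->
  phi (fun x => z * f x + g x) v = z *: phi f v + phi g v.
Proof. by move=> Cf Cg; rewrite (star_rep_linear rphi z Cf Cg). Qed.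

Lemma star_rep0 v : phi (fun _ => 0) v = 0.
Proof.
have := star_rep_lin (-1) v C0_zero C0_zero.
rewrite scaleN1r addNr => <-; congr (phi _ v); apply/funext => x; ring.
Qed.

Lemma star_repZ (z : Cplx R) f v : C0 f ->
  phi (fun x => z * f x) v = z *: phi f v.
Proof.
move=> Cf; have := star_rep_lin z v Cf C0_zero; rewrite star_rep0 addr0 => <-.
congr (phi _ v); apply/funext => x; ring.
Qed.

Lemma star_repM f g v : C0 f -> C0 g ->
  phi (fun x => f x * g x) v = phi f (phi g v).
Proof. by move=> Cf Cg; rewrite (star_rep_mul rphi Cf Cg). Qed.

Lemma star_repB f g v : C0 f -> C0 g ->
  phi (fun x => f x - g x) v = phi f v - phi g v.
Proof.
move=> Cf Cg; have := star_rep_lin (-1) v Cg Cf.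
rewrite scaleN1r [RHS]addrC => <-; congr (phi _ v); apply/funext => x; ring.
Qed.

Lemma star_repJ f v w : C0 f ->
  hdot (phi f v) w = hdot v (phi (fun x => Num.conj (f x)) w).
Proof. by move=> Cf; exact: (star_rep_adj rphi Cf). Qed.

(* If |f| <= c then c^2 - |f|^2 = c^2 (1 - g)^2 for a real function g in C_0(X),
   hence |phi(f) v|^2 = c^2 (|v|^2 - |v - phi(g) v|^2). *)
Lemma star_rep_le f (c : R) v : C0 f -> 0 < c -> (forall x, `|f x| <= toC c) ->
  `|phi f v| <= toC c * `|v|.
Proof.
move=> Cf c0 fc.
pose h x := Rpart `|f x| / c.
have h1 x : 0 <= h x <= 1.
  apply/andP; split.
    rewrite divr_ge0 ?(ltW c0) //.
    by have := normr_ge0 (f x); rewrite norm_toC_Rpart -toC0 toC_le.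
  by rewrite ler_pdivrMr // mul1r -toC_le -norm_toC_Rpart.
(* The square root of c^2 - |f|^2 does not vanish at infinity, so [phi] is not defined on it; its
   defect from c does. The bound k <= h below is what puts [g] into C_0(X). *)
pose k x := 1 - Num.sqrt (1 - h x ^+ 2).
have kh x : 0 <= k x <= h x.
  have /andP[h0 hle1] := h1 x; have h2 : h x ^+ 2 <= h x by rewrite expr2 ler_piMl.
  have h21 : h x ^+ 2 <= 1 by exact: le_trans h2 hle1.
  have s2 : Num.sqrt (1 - h x ^+ 2) ^+ 2 = 1 - h x ^+ 2.
    by rewrite sqr_sqrtr // subr_ge0.
  have s0 := sqrtr_ge0 (1 - h x ^+ 2).
  by rewrite /k; apply/andP; split; nra.
have k2 x : 2 * k x - k x ^+ 2 = h x ^+ 2.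
  have /andP[h0 hle1] := h1 x.
  have : (1 - k x) ^+ 2 = 1 - h x ^+ 2.
    by rewrite /k subKr sqr_sqrtr // subr_ge0 expr_le1.
  move=> e; have -> : 2 * k x - k x ^+ 2 = 1 - (1 - k x) ^+ 2 by ring.
  by rewrite e; ring.
pose g x : Cplx R := toC (k x).
have ch : continuous h.
  move=> x; apply: cvgM; last exact: cvg_cst.
  by apply: cvg_Rpart; apply: cvg_norm; case: Cf => cf _; exact: cf.
have Cg : C0 g.
  split.
    apply: continuous_Complex; last by move=> x; exact: cvg_cst.
    move=> x; apply: cvgB; first exact: cvg_cst.
    apply: (@continuous_comp _ _ _ (fun x => 1 - h x ^+ 2) Num.sqrt).
      apply: cvgB; first exact: cvg_cst.
      by apply: cvgM; exact: ch.
    exact: sqrt_continuous.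
  case: Cf => _ f0 e e0; have [K cK Kf] := f0 _ (mulr_gt0 e0 c0).
  exists K => // x /Kf; rewrite norm_toC_Rpart !norm_toC !toC_lt => fe.
  have /andP[k0 kx] := kh x; rewrite ger0_norm // (le_lt_trans kx) //.
  by rewrite /h ltr_pdivrMr.
have gJ : (fun x => Num.conj (g x)) = g.
  by apply/funext => x; exact: conj_toC.
have Cc := C0_conj Cf; have Cgg := C0_mul (bcf_C0 Cg) Cg.
have fE : (fun x => Num.conj (f x) * f x) =
    (fun x => toC (2 * c ^+ 2) * g x + toC (- c ^+ 2) * (g x * g x)).
  apply/funext => x; rewrite mulrC -normCK norm_toC_Rpart /g -!toCM -toCX -toCD.
  congr toC; have -> : Rpart `|f x| = h x * c by rewrite /h divfK ?gt_eqF.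
  by rewrite exprMn -k2; ring.
have vg : hdot (phi g v) v = hdot v (phi g v) by rewrite star_repJ // gJ.
have vgg : hdot (phi g v) (phi g v) = hdot v (phi g (phi g v)).
  by rewrite star_repJ // gJ.
have : `|phi f v| ^+ 2 = toC (c ^+ 2) * (`|v| ^+ 2 - `|v - phi g v| ^+ 2).
  rewrite !hdotE star_repJ // -star_repM // fE star_rep_lin //; last exact: C0_scale.
  rewrite (star_repZ _ _ Cgg) (star_repM _ Cg Cg) hdotBl !hdotBr hdotDr !hdotZr !conj_toC vg vgg.
  rewrite toCN [toC (2 * _)]toCM (_ : toC 2 = 2) ?toC_nat //; ring.
have c0' : 0 <= toC c :> Cplx R by rewrite -toC0 toC_le ltW.
move=> e; rewrite -(ler_pXn2r (n := 2)) ?nnegrE ?mulr_ge0 //.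
rewrite e exprMn -toCX; apply: ler_wpM2l; last by rewrite gerBl exprn_ge0.
by rewrite -toC0 toC_le sqr_ge0.
Qed.

End StarRep.

Section Expi.
Variable R : realType.
Implicit Types x y : R.

Lemma expiD x y : expi (x + y) = expi x * expi y.
Proof. by apply: CplxP; rewrite ?RpartM ?IpartM /= mulrDr ?cosD ?sinD; ring. Qed.

Lemma expi0 : expi (0 : R) = 1.
Proof. by rewrite /expi mulr0 cos0 sin0. Qed.

Lemma expiN x : expi (- x) = Num.conj (expi x).
Proof. by apply: CplxP; rewrite ?Rpart_conj ?Ipart_conj /= mulrN ?cosN ?sinN. Qed.

Lemma expiX x k : expi x ^+ k = expi (x * k%:R).
Proof.
elim: k => [|k IH]; first by rewrite mulr0 expi0.
by rewrite exprS IH -expiD -[in RHS]addn1 natrD mulrDr mulr1 addrC.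
Qed.

Lemma expi_norm x : `|expi x| = 1.
Proof. by rewrite normCplxE /= cos2Dsin2 sqrtr1. Qed.

Lemma expiJM x : Num.conj (expi x) * expi x = 1.
Proof. by rewrite -expiN -expiD addNr expi0. Qed.

Lemma expi_continuous : continuous (@expi R).
Proof.
apply: continuous_Complex => x.
  apply: (@continuous_comp _ _ _ (fun x => 2 * pi * x) cos); last exact: continuous_cos.
  exact: mulrl_continuous.
apply: (@continuous_comp _ _ _ (fun x => 2 * pi * x) sin); last exact: continuous_sin.
exact: mulrl_continuous.
Qed.

Lemma bcf_expi (X : topologicalType) (f : X -> R) :
  continuous f ->
  bounded_continuous_fun (fun z : X => expi (f z)).
Proof.
move=> cf; split.
  by move=> x; apply: continuous_comp; [exact: cf|exact: expi_continuous].
by exists 1 => x; rewrite expi_norm.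
Qed.
End Expi.

Lemma is_adjoint_unique (R : realType) (H : hilbert R) (T S S' : H -> H) :
  is_adjoint T S -> is_adjoint T S' -> forall v, S v = S' v.
Proof.
move=> a a' v; apply/eqP; rewrite -subr_eq0; apply/eqP/hdot_norm_eq0.
by rewrite hdotBr -a -a' subrr.
Qed.

Lemma bounded_op_id (R : realType) (H : hilbert R) : @bounded_op R H id.
Proof. by split => // x; exact: cvg_id. Qed.

Section LinearBounds.
Variables (R : realType) (V W : normedModType (Cplx R)).

Lemma linear_bound_continuous (f : V -> W) (c : R) : linear f ->
  (forall v, `|f v| <= toC c * `|v|) -> continuous f.
Proof.
move=> lf fc.
pose fL := HB.pack f (GRing.isLinear.Build _ _ _ _ f lf) : {linear V -> W}.
have c1 : 0 < `|c| + 1 by rewrite ltr_wpDl.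
have c1' : 0 < toC (`|c| + 1) :> Cplx R by rewrite -toC0 toC_lt.
move=> x; apply/cvgrPdist_lt => e e0; near=> u.
change (`|fL x - fL u| < e); rewrite -linearB.
apply: le_lt_trans (fc _) _.
apply: (@le_lt_trans _ _ (toC (`|c| + 1) * `|x - u|)).
  by rewrite ler_wpM2r // toC_le (le_trans (ler_norm _)) // lerDl.
rewrite mulrC -ltr_pdivlMr //; near: u.
by apply: cvgr_dist_lt; [exact: cvg_id|exact: divr_gt0].
Unshelve. all: by end_near. Qed.

Lemma continuous_linear_bound (f : V -> W) : linear f -> continuous f ->
  exists2 c : R, 0 < c & forall v, `|f v| <= toC c * `|v|.
Proof.
move=> lf cf.
pose fL := HB.pack f (GRing.isLinear.Build _ _ _ _ f lf) : {linear V -> W}.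
have /linear_boundedP[M [Mr Mf]] : bounded_near fL (nbhs 0).
  exact/continuous_linear_bounded/cf.
exists (`|Rpart M| + 1); first by rewrite ltr_wpDl.
apply: Mf; case: M Mr => a b; rewrite complex_real => /eqP -> /=.
by rewrite toC_lt (le_lt_trans (ler_norm _)) // ltrDl.
Qed.
End LinearBounds.

Lemma bounded_op_norm_le (R : realType) (H : hilbert R) (T : H -> H) :
  bounded_op T -> exists2 c : R, 0 < c & forall v, `|T v| <= toC c * `|v|.
Proof. by move=> [lT cT]; exact: continuous_linear_bound. Qed.

(* A form of nondegeneracy that passes to tensor products more easily than the
   totality of the range of phi. *)
Definition range_determining (R : realType) (X : topologicalType)
    (H : hilbert R) (phi : (X -> Cplx R) -> (H -> H)) :=
  forall (L : normedModType (Cplx R)) (S T : H -> L),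
    linear S -> continuous S -> linear T -> continuous T ->
    (forall f v, C0 f -> S (phi f v) = T (phi f v)) -> forall v, S v = T v.

Lemma nondegenerate_range_determining (R : realType) (X : topologicalType)
    (H : hilbert R) (phi : (X -> Cplx R) -> (H -> H)) :
  nondegenerate_rep phi -> range_determining phi.
Proof.
move=> nphi L S T lS cS lT cT ST; apply: (total_eq nphi.2) => //.
by move=> _ [f [v [Cf ->]]]; exact: ST.
Qed.

Section Multipliers.
Variables (R : realType) (X : topologicalType) (H : hilbert R).
Variable phi : (X -> Cplx R) -> (H -> H).
Hypothesis rphi : star_rep (@C0 R X) phi.
Hypothesis dphi : range_determining phi.
Implicit Types f g b : X -> Cplx R.

(** The functional z |-> <z, x - y> vanishes on the range of [phi], hence everywhere, in particular
    at x - y. *)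
Lemma range_hdot_eq x y :
  (forall f v, C0 f -> hdot (phi f v) x = hdot (phi f v) y) -> x = y.
Proof.
move=> xy; apply/eqP; rewrite -subr_eq0; apply/eqP/hdot_norm_eq0.
pose S z : (Cplx R)^o := hdot z (x - y).
suff: forall z, S z = (fun _ : H => 0 : (Cplx R)^o) z by apply.
apply: dphi.
- by move=> c u v; rewrite /S hdotDl hdotZl.
- exact: hdot_continuousl.
- by move=> c u v; rewrite scaler0 addr0.
- by move=> ?; exact: cvg_cst.
by move=> f v Cf; rewrite /S hdotBr xy // subrr.
Qed.

Lemma star_rep_op f : C0 f -> bounded_op (phi f).
Proof. exact: star_rep_bounded. Qed.

Lemma multiplier_value_range b T f v : multiplier_value phi b T -> C0 f ->
  T (phi f v) = phi (fun x => b x * f x) v.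
Proof. by move=> [_ mT] Cf; have /(congr1 (@^~ v)) := mT f Cf. Qed.

(** The definition of a multiplier value prescribes T only to the left of phi(f). On vectors phi(g)
    u both sides become phi of the same product of functions, and the range of [phi] determines the
    rest. *)
Lemma multiplier_value_left b T f v : multiplier_value phi b T ->
  bounded_continuous_fun b -> C0 f ->
  phi f (T v) = phi (fun x => b x * f x) v.
Proof.
move=> mT cb Cf; have Cbf := C0_mul cb Cf.
have [lT cT] := mT.1.
have [l1 c1] := bounded_op_comp (star_rep_op Cf) mT.1.
have [l2 c2] := star_rep_op Cbf.
apply: (dphi l1 c1 l2 c2) => g u Cg /=.
have Cbg := C0_mul cb Cg.
rewrite (multiplier_value_range u mT Cg) -!(star_repM rphi) //.
by congr (phi _ u); apply/funext => x; ring.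
Qed.

(** [S] is only known as an adjoint, not as a multiplier. Pairing with vectors phi(g) u moves it
    back to [T], where the function b is available. *)
Lemma multiplier_value_adjoint b T S f v : multiplier_value phi b T ->
  bounded_continuous_fun b -> is_adjoint T S -> C0 f ->
  S (phi f v) = phi (fun x => Num.conj (b x) * f x) v.
Proof.
move=> mT cb TS Cf; have Cbf := C0_mul (bcf_conj cb) Cf.
apply: range_hdot_eq => g u Cg.
have Cbg := C0_mul cb Cg.
rewrite -TS (multiplier_value_range u mT Cg) (star_repJ rphi) //.
rewrite (star_repJ rphi) // -!(star_repM rphi) //; try exact: C0_conj.
by congr (hdot u (phi _ v)); apply/funext => x; rewrite rmorphM; ring.
Qed.

Lemma multiplier_value_unitary b T S : multiplier_value phi b T ->
  bounded_continuous_fun b -> bounded_op S -> is_adjoint T S ->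
  (forall x, Num.conj (b x) * b x = 1) ->
  (forall v, S (T v) = v) /\ (forall v, T (S v) = v).
Proof.
move=> mT cb bS TS b1.
have [li ci] := @bounded_op_id R H.
have [l1 c1] := bounded_op_comp bS mT.1; have [l2 c2] := bounded_op_comp mT.1 bS.
split; [apply: (dphi l1 c1 li ci)|apply: (dphi l2 c2 li ci)];
  move=> f v Cf /=.
- rewrite (multiplier_value_range v mT Cf).
  rewrite (multiplier_value_adjoint v mT cb TS) //; last exact: C0_mul.
  by congr (phi _ v); apply/funext => x; rewrite mulrA b1 mul1r.
- rewrite (multiplier_value_adjoint v mT cb TS) //.
  rewrite (multiplier_value_range v mT) //; last exact/C0_mul/Cf/bcf_conj.
  by congr (phi _ v); apply/funext => x; rewrite mulrA [b x * _]mulrC b1 mul1r.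
Qed.

End Multipliers.

(** * Commutation of Rop with w (x) 1 *)

Section TensorProduct.
Variables (R : realType) (H K : hilbert R) (tens : H -> H -> K).
Hypothesis htens : hilbert_tensor tens.
Implicit Types u v w : H.

(** Bilinearity is not part of [hilbert_tensor]. It follows because the inner products with the
    total set of elementary tensors determine a vector, and these are linear in v. *)
Lemma tens_linearl w : linear (fun v => tens v w).
Proof.
move=> z u v; apply: (total_hdot_eq htens.2) => _ [u' [v' ->]].
by rewrite hdotDr hdotZr !htens.1 hdotDr hdotZr; ring.
Qed.

Lemma tens_linearr v : linear (tens v).
Proof.
move=> z u w; apply: (total_hdot_eq htens.2) => _ [u' [v' ->]].
by rewrite hdotDr hdotZr !htens.1 hdotDr hdotZr; ring.
Qed.

Lemma tens_norm v w : `|tens v w| = `|v| * `|w|.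
Proof.
apply/eqP; rewrite -(eqrXn2 (n := 2)) ?mulr_ge0 //.
by rewrite exprMn !hdotE htens.1.
Qed.

Lemma tens_continuousl w : continuous (fun v => tens v w).
Proof.
apply: (linear_bound_continuous (c := Rpart `|w|) (tens_linearl w)) => v.
by rewrite -(ge0_toC (normr_ge0 _)) tens_norm mulrC.
Qed.

Lemma tens_continuousr v : continuous (tens v).
Proof.
apply: (linear_bound_continuous (c := Rpart `|v|) (tens_linearr v)) => w.
by rewrite -(ge0_toC (normr_ge0 _)) tens_norm.
Qed.

Lemma tens_total_eq (L : normedModType (Cplx R)) (S T : set H) (f g : K -> L) :
  Defs.total S -> Defs.total T ->
  linear f -> continuous f -> linear g -> continuous g ->
  (forall v w, S v -> T w -> f (tens v w) = g (tens v w)) ->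
  forall x, f x = g x.
Proof.
move=> tS tT lf cf lg cg fg; apply: (total_eq htens.2) => // _ [v [w ->]].
have compl h u : linear h -> linear (h \o tens^~ u : H -> L).
  by move=> lh z x y /=; rewrite tens_linearl lh.
have compr h u : linear h -> linear (h \o tens u : H -> L).
  by move=> lh z x y /=; rewrite tens_linearr lh.
have ccl h u : continuous h -> continuous (h \o tens^~ u : H -> L).
  by move=> ch x; apply: continuous_comp; [exact: tens_continuousl|exact: ch].
have ccr h u : continuous h -> continuous (h \o tens u : H -> L).
  by move=> ch x; apply: continuous_comp; [exact: tens_continuousr|exact: ch].
apply: (total_eq tS (compl f w lf) (ccl f w cf) (compl g w lg) (ccl g w cg)).
move=> {}v Sv /=.
apply: (total_eq tT (compr f v lf) (ccr f v cf) (compr g v lg) (ccr g v cg)).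
by move=> {}w Tw; exact: fg.
Qed.

Lemma tens_eq (L : normedModType (Cplx R)) (f g : K -> L) :
  linear f -> continuous f -> linear g -> continuous g ->
  (forall v w, f (tens v w) = g (tens v w)) -> forall x, f x = g x.
Proof.
by move=> lf cf lg cg fg; apply: (total_eq htens.2) => // _ [v [w ->]].
Qed.

End TensorProduct.

Section ElementaryFunctions.
Variable R : realType.
Implicit Types f g : R -> Cplx R.

Definition tensf f g : R * R -> Cplx R := fun p => f p.1 * g p.2.

Lemma bcf_fst f : bounded_continuous_fun f ->
  bounded_continuous_fun (fun p : R * R => f p.1).
Proof.
move=> [cf [c fc]]; split; last by exists c.
by move=> p; apply: continuous_comp; [exact: cvg_fst|exact: cf].
Qed.

Lemma bcf_snd f : bounded_continuous_fun f ->
  bounded_continuous_fun (fun p : R * R => f p.2).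
Proof.
move=> [cf [c fc]]; split; last by exists c.
by move=> p; apply: continuous_comp; [exact: cvg_snd|exact: cf].
Qed.

Lemma C0_tensf f g : C0 f -> C0 g -> C0 (tensf f g).
Proof.
move=> Cf Cg; have [cfg _] := bcf_mul (bcf_fst (bcf_C0 Cf)) (bcf_snd (bcf_C0 Cg)).
split=> // e e0.
have [c c0 fc] := C0_bounded Cf; have [d d0 gd] := C0_bounded Cg.
have [A cA fA] := Cf.2 _ (divr_gt0 e0 d0).
have [B cB gB] := Cg.2 _ (divr_gt0 e0 c0).
exists (A `*` B); first exact: compact_setX.
move=> p /not_andP[/fA|/gB] h; rewrite normrM.
- rewrite -[e](divfK (lt0r_neq0 d0)) toCM.
  apply: le_lt_trans (_ : `|f p.1| * toC d < _); first by rewrite ler_wpM2l.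
  by rewrite ltr_pM2r // -toC0 toC_lt.
- rewrite -[e](divfK (lt0r_neq0 c0)) mulrC toCM.
  apply: le_lt_trans (_ : `|g p.2| * toC c < _); first by rewrite ler_wpM2l.
  by rewrite ltr_pM2r // -toC0 toC_lt.
Qed.

(** Both projections of a compact set are bounded, so compact sets may be replaced by squares, on
    which Rhat will be approximated. *)
Lemma C0_ball (h : R * R -> Cplx R) (e : R) : C0 h -> 0 < e ->
  exists2 B : R, 0 < B & forall p, `|p.1| > B \/ `|p.2| > B -> `|h p| < toC e.
Proof.
move=> Ch e0; have [K cK Kh] := Ch.2 _ e0.
have bnd (q : R * R -> R) : continuous q ->
    exists2 B : R, 0 < B & forall p, K p -> `|q p| <= B.
  move=> cq; have : compact (q @` K).
    by apply: continuous_compact => //; exact: continuous_subspaceT.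
  move=> /compact_bounded[M [Mr Mq]].
  exists (Num.max 1 (M + 1)); first by rewrite lt_max ltr01.
  move=> p Kp; rewrite le_max; apply/orP; right.
  by apply: (Mq (M + 1)); [rewrite ltrDl|exists p].
have [B B0 KB] := bnd fst (fun p => @cvg_fst _ _ _ _ _).
have [C C0 KC] := bnd snd (fun p => @cvg_snd _ _ _ _ _).
exists (Num.max B C) => [|p pBC]; first by rewrite lt_max B0.
apply: Kh => Kp; case: pBC; rewrite gt_max => /andP[pB pC].
- by have := KB _ Kp; rewrite leNgt pB.
- by have := KC _ Kp; rewrite leNgt pC.
Qed.

End ElementaryFunctions.

Section Intertwining.
Variables (R : realType) (H K : hilbert R) (tens : H -> H -> K).
Hypothesis htens : hilbert_tensor tens.
Variable phi : (R -> Cplx R) -> (H -> H).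
Hypothesis nphi : nondegenerate_rep phi.
Variable phi2 : (R * R -> Cplx R) -> (K -> K).
Hypothesis tphi2 : tensor_rep tens phi phi2.
Implicit Types (b F G : R * R -> Cplx R) (f g : R -> Cplx R).

Let rphi : star_rep (@C0 R R) phi := nphi.1.
Let dphi := nondegenerate_range_determining nphi.
Let rphi2 : star_rep (@C0 R (R * R)%type) phi2 := tphi2.1.

Lemma tensor_repE f g v w : C0 f -> C0 g ->
  phi2 (tensf f g) (tens v w) = tens (phi f v) (phi g w).
Proof. by move=> Cf Cg; rewrite (tphi2.2 _ _ Cf Cg).2. Qed.

Lemma tensor_rep_eq (L : normedModType (Cplx R)) (S T : K -> L) :
  linear S -> continuous S -> linear T -> continuous T ->
  (forall f g v w, C0 f -> C0 g ->
     S (phi2 (tensf f g) (tens v w)) = T (phi2 (tensf f g) (tens v w))) ->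
  forall x, S x = T x.
Proof.
move=> lS cS lT cT ST.
apply: (tens_total_eq htens nphi.2 nphi.2) => //.
move=> _ _ [f [v [Cf ->]]] [g [w [Cg ->]]].
by rewrite -tensor_repE // ST.
Qed.

(** Gives access to the multiplier lemmas for [phi2]: [tensor_rep] does not state nondegeneracy, but
    it is inherited from the two legs. *)
Lemma tensor_rep_range_determining : range_determining phi2.
Proof.
move=> L S T lS cS lT cT ST; apply: tensor_rep_eq => // f g v w Cf Cg.
exact/ST/C0_tensf.
Qed.

(** Taking adjoints turns the hypothesis into orthogonality of x - y to all vectors phi2(f (x) g) z.
    It serves to cancel a factor phi2(f (x) g) on the left of an equation. *)
Lemma tensor_rep_inj x y :
  (forall f g, C0 f -> C0 g -> phi2 (tensf f g) x = phi2 (tensf f g) y) ->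
  x = y.
Proof.
move=> xy; apply/eqP; rewrite -subr_eq0; apply/eqP/hdot_norm_eq0.
pose S z : (Cplx R)^o := hdot z (x - y).
suff: forall z, S z = (fun _ : K => 0 : (Cplx R)^o) z by apply.
apply: tensor_rep_eq.
- by move=> c u v; rewrite /S hdotDl hdotZl.
- exact: hdot_continuousl.
- by move=> c u v; rewrite scaler0 addr0.
- by move=> ?; exact: cvg_cst.
move=> f g v w Cf Cg; rewrite /S (star_repJ rphi2); last exact: C0_tensf.
have -> : (fun p => Num.conj (tensf f g p)) =
    tensf (fun t => Num.conj (f t)) (fun t => Num.conj (g t)).
  by apply/funext => p; rewrite /tensf rmorphM.
have Ch := C0_tensf (C0_conj Cf) (C0_conj Cg).
have [lh _] := star_rep_bounded rphi2 Ch.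
by rewrite (linear_mapB lh) (xy _ _ (C0_conj Cf) (C0_conj Cg)) subrr hdot0r.
Qed.

Variables (X : K -> K) (w : H -> H) (U : R -> H -> H) (c : R).
Hypothesis tX : tensor_op tens w id X.
Hypothesis rU : rep_of_C0 phi U.
Hypothesis Uw : forall x v, U x (w v) = expi (- (c * x)) *: w (U x v).

(** As U_x is phi of xi |-> e^(-2 pi i xi x), the relation [Uw] says that [w] carries the spectral
    value xi to xi + c. Moving a function past X = w (x) 1 thus translates its first variable by
    c. *)
Definition shift_fst b : R * R -> Cplx R := fun p => b (p.1 + c, p.2).

Lemma bcf_shift b : bounded_continuous_fun b -> bounded_continuous_fun (shift_fst b).
Proof.
move=> [cb [d bd]]; split; last by exists d => p; exact: bd.
move=> p; apply: (@continuous_comp _ _ _ (fun p : R * R => (p.1 + c, p.2)) b).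
  have h1 : (fun q : R * R => q.1 + c) @ p --> p.1 + c.
    by apply: cvgD; [exact: cvg_fst|exact: cvg_cst].
  have h2 : snd @ p --> p.2 by exact: cvg_snd.
  exact: (cvg_pair h1 h2).
exact: cb.
Qed.

(* Formally: phi2(b) X = X phi2(shift_fst b) for the extension of phi2 to bounded
   continuous functions. *)
Definition intertwined b := bounded_continuous_fun b /\
  forall F G x, C0 F -> C0 G ->
    phi2 (fun p => b p * F p) (X (phi2 G x)) =
    phi2 F (X (phi2 (fun p => shift_fst b p * G p) x)).

(** Functions commute with one another under [phi2], so general F and G can be traded for elementary
    tensors inserted at the outer ends of the equation and then cancelled by totality. *)
Lemma intertwined_tensf b : bounded_continuous_fun b ->
  (forall f g f' g' u v, C0 f -> C0 g -> C0 f' -> C0 g' ->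
    phi2 (fun p => b p * tensf f' g' p) (X (phi2 (tensf f g) (tens u v))) =
    phi2 (tensf f' g') (X (phi2 (fun p => shift_fst b p * tensf f g p) (tens u v)))) ->
  intertwined b.
Proof.
move=> cb be; split=> // F G x CF CG.
have cs := bcf_shift cb.
have bop G' : C0 G' -> bounded_op (phi2 G') by exact: star_rep_bounded.
have bX := tX.1.
have be1 f g f' g' y : C0 f -> C0 g -> C0 f' -> C0 g' ->
    phi2 (fun p => b p * tensf f' g' p) (X (phi2 (tensf f g) y)) =
    phi2 (tensf f' g') (X (phi2 (fun p => shift_fst b p * tensf f g p) y)).
  move=> Cf Cg Cf' Cg'; move: y.
  have Ct := C0_tensf Cf Cg; have Ct' := C0_tensf Cf' Cg'.
  have [l1 c1] := bounded_op_comp (bop _ (C0_mul cb Ct')) (bounded_op_comp bX (bop _ Ct)).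
  have [l2 c2] := bounded_op_comp (bop _ Ct') (bounded_op_comp bX (bop _ (C0_mul cs Ct))).
  apply: (tens_eq htens l1 c1 l2 c2) => u v /=; exact: be.
(* General F: after multiplication by phi2(f' (x) g') on the left, F and f' (x) g' change places and
   [be1] applies. *)
have be2 f g y : C0 f -> C0 g ->
    phi2 (fun p => b p * F p) (X (phi2 (tensf f g) y)) =
    phi2 F (X (phi2 (fun p => shift_fst b p * tensf f g p) y)).
  move=> Cf Cg; apply: tensor_rep_inj => f' g' Cf' Cg'.
  have Ct' := C0_tensf Cf' Cg'.
  rewrite -!(star_repM rphi2) //; last exact: C0_mul.
  transitivity (phi2 F (phi2 (fun p => b p * tensf f' g' p)
                         (X (phi2 (tensf f g) y)))).
    rewrite -(star_repM rphi2) //; last exact: C0_mul.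
    by congr (phi2 _ _); apply/funext => p; ring.
  rewrite be1 // -(star_repM rphi2) //.
  by congr (phi2 _ _); apply/funext => p; ring.
have [l1 c1] := bounded_op_comp (bop _ (C0_mul cb CF)) (bounded_op_comp bX (bop _ CG)).
have [l2 c2] := bounded_op_comp (bop _ CF) (bounded_op_comp bX (bop _ (C0_mul cs CG))).
(* General G: x may be taken in the range of phi2(f (x) g), and then G and f (x) g change places. *)
move: x; apply: (tensor_rep_eq l1 c1 l2 c2) => f g u v Cf Cg /=.
have Ct := C0_tensf Cf Cg; have CbG := C0_mul cs CG; have Cbt := C0_mul cs Ct.
rewrite -!(star_repM rphi2) //.
have comm1 : (fun p => G p * tensf f g p) = (fun p => tensf f g p * G p).
  by apply/funext => p; ring.
have comm2 : (fun p => shift_fst b p * G p * tensf f g p) =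
    (fun p => shift_fst b p * tensf f g p * G p).
  by apply/funext => p; ring.
by rewrite comm1 comm2 (star_repM rphi2 _ Ct CG) (star_repM rphi2 _ Cbt CG) be2.
Qed.

Lemma bcf_pairing (x : R) :
  bounded_continuous_fun (fun xi : R => Num.conj (pairing xi x)).
Proof.
apply/bcf_conj/(@bcf_expi _ _ (fun xi : R => xi * x)).
exact: mulrr_continuous.
Qed.

(** Here [Uw] enters: the multiplier with this function is U_x, and the scalar in [Uw] is exactly
    the factor by which the character changes under xi |-> xi + c. *)
Lemma intertwined_character x :
  intertwined (fun p => Num.conj (pairing p.1 x)).
Proof.
have cp := bcf_pairing x.
apply: intertwined_tensf => [|f g f' g' u v Cf Cg Cf' Cg']; first exact: bcf_fst cp.
set e := expi (- (c * x)).
have Cpf := C0_mul cp Cf.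
have -> : (fun p : R * R => Num.conj (pairing p.1 x) * tensf f' g' p) =
    tensf (fun t => Num.conj (pairing t x) * f' t) g'.
  by apply/funext => p; rewrite /tensf mulrA.
have -> : (fun p : R * R => shift_fst (fun p => Num.conj (pairing p.1 x)) p * tensf f g p) =
    (fun p => e * tensf (fun t => Num.conj (pairing t x) * f t) g p).
  apply/funext => p; rewrite /tensf /shift_fst /= /pairing mulrDl expiD rmorphM.
  by rewrite /e expiN; ring.
have Ct := C0_tensf Cpf Cg.
have Cpf' := C0_mul cp Cf'.
rewrite (star_repZ rphi2 e _ Ct) !tensor_repE //.
have [lX _] := tX.1; have [lt _] := star_rep_bounded rphi2 (C0_tensf Cf' Cg').
rewrite !tX.2 (linear_mapZ lX) (linear_mapZ lt) tX.2 tensor_repE //.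
rewrite -(multiplier_value_left rphi dphi _ (rU x) cp Cf').
rewrite -(multiplier_value_range _ (rU x) Cf) Uw.
rewrite (linear_mapZ (star_rep_bounded rphi Cf').1).
by rewrite (linear_mapZ (tens_linearl htens _)) tensor_repE.
Qed.

(** [X] acts as the identity on the second leg, so functions of eta pass it unchanged. *)
Lemma intertwined_snd (h : R -> Cplx R) : bounded_continuous_fun h ->
  intertwined (fun p => h p.2).
Proof.
move=> ch; apply: intertwined_tensf => [|f g f' g' u v Cf Cg Cf' Cg'].
  exact: bcf_snd.
have Chg := C0_mul ch Cg; have Chg' := C0_mul ch Cg'.
have -> : (fun p : R * R => h p.2 * tensf f' g' p) =
    tensf f' (fun t => h t * g' t).
  by apply/funext => p; rewrite /tensf; ring.
have -> : (fun p : R * R => shift_fst (fun p => h p.2) p * tensf f g p) =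
    tensf f (fun t => h t * g t).
  by apply/funext => p; rewrite /tensf /shift_fst /=; ring.
rewrite !tensor_repE // !tX.2 !tensor_repE // -!(star_repM rphi) //.
by congr (tens _ (phi _ v)); apply/funext => t; ring.
Qed.

Lemma intertwined_lin z b1 b2 : intertwined b1 -> intertwined b2 ->
  intertwined (fun p => z * b1 p + b2 p).
Proof.
move=> [c1 i1] [c2 i2]; split=> [|F G x CF CG]; first exact: bcf_lin.
have CF1 := C0_mul c1 CF; have CF2 := C0_mul c2 CF.
have CG1 := C0_mul (bcf_shift c1) CG; have CG2 := C0_mul (bcf_shift c2) CG.
transitivity (phi2 (fun p => z * (b1 p * F p) + b2 p * F p) (X (phi2 G x))).
  by congr (phi2 _ _); apply/funext => p; ring.
rewrite (star_rep_lin rphi2) // i1 // i2 //.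
transitivity (phi2 F (X (phi2 (fun p => z * (shift_fst b1 p * G p) + shift_fst b2 p * G p) x))).
  rewrite (star_rep_lin rphi2) // tX.1.1.
  by rewrite (star_rep_bounded rphi2 CF).1.
by congr (phi2 F (X (phi2 _ x))); apply/funext => p; rewrite /shift_fst; ring.
Qed.

Lemma intertwined_mul b1 b2 : intertwined b1 -> intertwined b2 ->
  intertwined (fun p => b1 p * b2 p).
Proof.
move=> [c1 i1] [c2 i2]; split=> [|F G x CF CG]; first exact: bcf_mul.
have CF2 := C0_mul c2 CF; have CG1 := C0_mul (bcf_shift c1) CG.
transitivity (phi2 (fun p => b1 p * (b2 p * F p)) (X (phi2 G x))).
  by congr (phi2 _ _); apply/funext => p; ring.
rewrite i1 // i2 //.
by congr (phi2 F (X (phi2 _ x))); apply/funext => p; rewrite /shift_fst; ring.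
Qed.

Lemma intertwined_cst z : intertwined (fun _ => z).
Proof. exact: (intertwined_snd (h := fun _ => z) (bcf_cst _ _)). Qed.

Lemma intertwined_exp b n : intertwined b -> intertwined (fun p => b p ^+ n).
Proof.
move=> ib; elim: n => [|n IH]; first exact: intertwined_cst 1.
rewrite (_ : (fun p => _) = (fun p => b p * b p ^+ n)); last first.
  by apply/funext => p; rewrite exprS.
exact: intertwined_mul.
Qed.

End Intertwining.

(** * Approximation of Rhat by trigonometric polynomials in xi, uniformly bounded and uniform on
    squares *)

Section TrigonometricBounds.
Variable R : realType.
Implicit Types x y t : R.

Lemma lipschitz_deriv (f df : R -> R) (c : R) :
  (forall x, is_derive x 1 f (df x)) -> (forall x, `|df x| <= c) ->
  forall x y, `|f x - f y| <= c * `|x - y|.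
Proof.
move=> fd dfc.
have cf : continuous f.
  by move=> x; apply/differentiable_continuous/derivable1_diffP; case: (fd x).
have le x y : y <= x -> `|f x - f y| <= c * `|x - y|.
  move=> yx; have [z _ ->] := MVT_segment yx (fun x _ => fd x) (continuous_subspaceT cf).
  by rewrite normrM ler_wpM2r.
move=> x y; have [/le//|/ltW/le] := leP y x.
by rewrite distrC [`|y - x|]distrC.
Qed.

Lemma sin_lipschitz x y : `|sin x - sin y| <= `|x - y|.
Proof.
rewrite -[leRHS]mul1r; apply: (lipschitz_deriv (df := cos)) => z.
exact: cos_max.
Qed.

Lemma cos_lipschitz x y : `|cos x - cos y| <= `|x - y|.
Proof.
rewrite -[leRHS]mul1r; apply: (lipschitz_deriv (df := fun x => - sin x)) => z.
by rewrite normrN; exact: sin_max.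
Qed.

Lemma norm_sin_le t : `|sin t| <= `|t|.
Proof. by have := sin_lipschitz t 0; rewrite sin0 !subr0. Qed.

Lemma one_sub_cos t : 1 - cos t = 2 * sin (t / 2) ^+ 2.
Proof.
rewrite {1}[t]splitr cosD.
have -> : cos (t / 2) * cos (t / 2) - sin (t / 2) * sin (t / 2) =
    cos (t / 2) ^+ 2 + sin (t / 2) ^+ 2 - 2 * sin (t / 2) ^+ 2 by ring.
by rewrite cos2Dsin2; ring.
Qed.

Lemma one_sub_cos_le t : 0 <= 1 - cos t <= t ^+ 2 / 2.
Proof.
rewrite one_sub_cos mulr_ge0 ?sqr_ge0 //=.
have : sin (t / 2) ^+ 2 <= (t / 2) ^+ 2.
  rewrite -[leLHS]real_normK ?num_real // -[leRHS]real_normK ?num_real //.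
  by rewrite ler_pXn2r ?nnegrE // norm_sin_le.
by move=> h; nra.
Qed.

Lemma sin_sub_le t : `|sin t - t| <= `|t| ^+ 3.
Proof.
have pos x : 0 <= x -> `|sin x - x| <= x ^+ 3.
  move=> x0.
  have fd (z : R) : is_derive z 1 (fun x : R => sin x - x) (cos z - 1).
    by apply: is_deriveB.
  have cf : continuous (fun x : R => sin x - x).
    by move=> z; apply/differentiable_continuous/derivable1_diffP; case: (fd z).
  have [z] := MVT_segment x0 (fun x _ => fd x) (continuous_subspaceT cf).
  rewrite in_itv /= sin0 !subr0 => /andP[z0 zx] ->.
  rewrite normrM (ger0_norm x0) exprSr ler_wpM2r // distrC.
  have /andP[c0 cz] := one_sub_cos_le z.
  rewrite ger0_norm // (le_trans cz) //; nra.
have [t0|t0] := leP 0 t; first by rewrite [`|t|]ger0_norm // pos.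
rewrite [`|t|]ltr0_norm //; have := pos (- t); rewrite oppr_ge0 => /(_ (ltW t0)).
by rewrite sinN -opprD normrN.
Qed.

End TrigonometricBounds.

(** x^n - y^n is x - y times a sum of n products of powers, and only the powers of x with exponent
    below n have to be bounded. *)
Lemma dist_exprn_le (R : realType) (x y : Cplx R) (c : R) n :
  (forall i, (i < n)%N -> `|x| ^+ i <= toC c) -> `|y| = 1 ->
  `|x ^+ n - y ^+ n| <= `|x - y| * (toC c *+ n).
Proof.
move=> xc y1; rewrite subrXX normrM ler_wpM2l //.
apply: le_trans (ler_norm_sum _ _ _) _.
rewrite -[X in _ *+ X]card_ord -sumr_const; apply: ler_sum => i _.
rewrite normrM !normrX y1 expr1n mulr1 xc // (leq_ltn_trans (leq_subr _ _)) // ltn_predL.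
exact: leq_ltn_trans (ltn_ord i).
Qed.

Section RhatApproximation.
Variable R : realType.
Implicit Types t : R.

Lemma exp_sub_linear t : `|t| <= 1 ->
  `|Complex 1 t - Complex (cos t) (sin t) : Cplx R| <= toC (2 * t ^+ 2).
Proof.
move=> t1; apply: le_trans (norm_le_RI _) _; rewrite toC_le /=.
have /andP[c0 c1] := one_sub_cos_le t; rewrite (ger0_norm c0) distrC.
have := sin_sub_le t; have : `|t| ^+ 3 <= t ^+ 2.
  by rewrite exprS real_normK ?num_real // ler_piMl // sqr_ge0.
by move=> h1 h2; have := sqr_ge0 t; lra.
Qed.

Lemma expi_exp t n : (0 < n)%N ->
  (Complex (cos (t / n%:R)) (sin (t / n%:R)) : Cplx R) ^+ n = Complex (cos t) (sin t).
Proof.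
move=> n0; have e s : (Complex (cos s) (sin s) : Cplx R) = expi (s / (2 * pi)).
  by rewrite /expi mulrCA divff ?mulr1 // mulf_neq0 // gt_eqF // pi_gt0.
rewrite !e expiX; congr expi; rewrite mulrAC divfK // pnatr_eq0 -lt0n //.
Qed.

(* (1 + is/n)^n converges to e^(is), uniformly for s^2 <= n and with error
   O(s^2/n). *)
Lemma exp_approx t n : (0 < n)%N -> t ^+ 2 <= n%:R ->
  `|(Complex 1 (t / n%:R) : Cplx R) ^+ n| <= toC (expR 1) /\
  `|(Complex 1 (t / n%:R) : Cplx R) ^+ n - Complex (cos t) (sin t)| <=
    toC (2 * expR 1 * t ^+ 2 / n%:R).
Proof.
move=> n0 tn; have nR : 0 < n%:R :> R by rewrite ltr0n.
have n1 : 1 <= n%:R :> R by rewrite ler1n.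
set s := t / n%:R.
have s2 : s ^+ 2 <= n%:R^-1.
  by rewrite /s exprMn exprVn ler_pdivrMr ?exprn_gt0 // expr2 mulKf ?gt_eqF.
have e1 : 1 <= expR 1 :> R by rewrite (le_trans _ (expR_ge1Dx _)) // lerDl.
(* The squared modulus is 1 + s^2 <= 1 + 1/n, so its powers up to n stay below (1 + 1/n)^n <= e <=
   e^2. *)
have pw i : (i <= n)%N -> `|Complex 1 s : Cplx R| ^+ i <= toC (expR 1).
  move=> ilen; have e0 : 0 <= toC (expR 1) :> Cplx R by rewrite -toC0 toC_le expR_ge0.
  rewrite -(ler_pXn2r (n := 2)) ?nnegrE ?exprn_ge0 // exprAC sqr_normCplx.
  rewrite -!toCX toC_le expr1n.
  apply: (@le_trans _ _ ((1 + n%:R^-1) ^+ n)).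
    apply: (@le_trans _ _ ((1 + n%:R^-1) ^+ i)).
      by apply: lerXn2r; rewrite ?nnegrE ?addr_ge0 ?sqr_ge0 ?invr_ge0 ?lerD2l ?(ltW nR).
    by rewrite ler_weXn2l // lerDl invr_ge0 ltW.
  apply: (@le_trans _ _ (expR 1)); last by rewrite expr2 ler_peMr // expR_ge0.
  apply: (@le_trans _ _ (expR (n%:R^-1) ^+ n)).
    by apply: lerXn2r; rewrite ?nnegrE ?expR_ge0 ?addr_ge0 ?invr_ge0 ?expR_ge1Dx ?(ltW nR).
  by rewrite -expRM_natl mulfV ?gt_eqF.
have s1 : `|s| <= 1.
  rewrite -(ler_pXn2r (n := 2)) ?nnegrE // real_normK ?num_real // expr1n.
  by rewrite (le_trans s2) // invf_le1.
split; first by rewrite normrX pw.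
rewrite -(expi_exp t n0).
apply: le_trans (dist_exprn_le (c := expR 1) _ _) _.
- by move=> i /ltnW; exact: pw.
- by apply/eqP; rewrite -(eqrXn2 (n := 2)) // sqr_normCplx cos2Dsin2 expr1n.
apply: (@le_trans _ _ (toC (2 * s ^+ 2) * (toC (expR 1) *+ n))).
  by rewrite ler_wpM2r ?mulrn_wge0 ?exp_sub_linear // -toC0 toC_le expR_ge0.
have -> : toC (expR 1) *+ n = toC (expR 1 * n%:R) :> Cplx R.
  by rewrite toCM toC_nat mulr_natr.
rewrite -toCM toC_le /s exprMn exprVn.
by rewrite le_eqVlt; apply/orP; left; apply/eqP; field; rewrite gt_eqF.
Qed.

Lemma scaled_sin_approx (L x B : R) : 1 <= L -> `|x| <= B ->
  `|L * sin (x / L)| <= `|x| /\ `|L * sin (x / L) - x| <= B ^+ 3 / L.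
Proof.
move=> L1 xB; have L0 : 0 < L by rewrite (lt_le_trans _ L1).
split.
  rewrite normrM (gtr0_norm L0) -ler_pdivlMl // mulrC.
  by rewrite (le_trans (norm_sin_le _)) // normrM [`|L^-1|]gtr0_norm ?invr_gt0.
have -> : L * sin (x / L) - x = L * (sin (x / L) - x / L).
  by field; rewrite gt_eqF.
rewrite normrM (gtr0_norm L0) -ler_pdivlMl // (le_trans (sin_sub_le _)) //.
rewrite normrM [`|L^-1|]gtr0_norm ?invr_gt0 // exprMn.
have y0 : 0 <= L^-1 by rewrite invr_ge0 ltW.
have -> : L^-1 * (B ^+ 3 / L) = B ^+ 3 * L^-1 ^+ 2 by ring.
apply: ler_pM; rewrite ?exprn_ge0 //.
  by apply: lerXn2r; rewrite ?nnegrE // (le_trans _ xB).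
by apply: ler_wiXn2l => //; rewrite invf_le1.
Qed.

(* The approximants are polynomials in sin (xi / L) and sin (eta / L), hence
   combinations of characters, and they are bounded independently of B and e. *)
Lemma Rhat_approx (a B e : R) : 0 < e -> exists (L : R) (n : nat),
  let b := fun p : R * R =>
    (Complex 1 (2 * pi * a * (L * sin (p.1 / L)) * (L * sin (p.2 / L)) / n%:R) :
       Cplx R) ^+ n in
  [/\ 0 < L, forall p, `|b p| <= toC (expR 1) &
      forall p, `|p.1| <= B -> `|p.2| <= B -> `|b p - Rhat a p| <= toC e].
Proof.
move=> e0; pose A := 2 * pi * `|a|.
have A0 : 0 <= A by rewrite /A !mulr_ge0 ?pi_ge0.
have aA : `|2 * pi * a| = A.
  by rewrite /A !normrM [`|2|]ger0_norm // [`|pi|]ger0_norm ?pi_ge0.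
(* On the square the phase changes by at most 2 A B^4 / L when xi and eta are replaced by L sin(xi /
   L) and L sin(eta / L); this [L] makes it at most e / 4. *)
pose L := 1 + 8 * A * `|B| ^+ 4 / e.
have L1 : 1 <= L.
  rewrite lerDl; apply: divr_ge0; last exact: ltW.
  by apply: mulr_ge0; [exact: mulr_ge0|exact: exprn_ge0].
have L0 : 0 < L by rewrite (lt_le_trans _ L1).
(* (A L^2)^2 bounds s^2 on the whole plane, as |sin| <= 1. The summand 1 gives s^2 <= n, hence the
   global bound by [expR 1]; the other summand brings the error of [exp_approx] below e / 2. *)
pose M := (A * L ^+ 2) ^+ 2 * (1 + 4 * expR 1 / e).
have [n nM] : exists n : nat, M < n.+1%:R.
  by exists (Num.trunc M); exact: truncnS_gt.
have n0 : 0 < n.+1%:R :> R by [].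
have sM p (s := 2 * pi * a * (L * sin (p.1 / L)) * (L * sin (p.2 / L))) :
    s ^+ 2 <= (A * L ^+ 2) ^+ 2.
  rewrite -[leLHS]real_normK ?num_real // ler_pXn2r ?nnegrE //; last first.
    by apply: mulr_ge0; rewrite ?exprn_ge0 ?(ltW L0).
  rewrite /s normrM normrM aA -mulrA ler_wpM2l // expr2.
  by rewrite ler_pM // normrM (gtr0_norm L0) ler_piMr ?sin_max // ltW.
have e1 : 0 < expR 1 :> R by exact: expR_gt0.
have r1 : 0 <= 4 * expR 1 / e by rewrite !mulr_ge0 ?invr_ge0 ?ltW.
exists L, n.+1 => b; split=> // p; rewrite /b; set s := 2 * pi * a * _ * _; have := sM p;
  rewrite -/s => ss.
  have sn : s ^+ 2 <= n.+1%:R.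
    by rewrite (le_trans ss) // (le_trans _ (ltW nM)) // ler_peMr ?sqr_ge0 // lerDl.
  by have [] := exp_approx (ltn0Sn n) sn.
move=> p1B p2B.
have sn : s ^+ 2 <= n.+1%:R.
  by rewrite (le_trans ss) // (le_trans _ (ltW nM)) // ler_peMr ?sqr_ge0 // lerDl.
have [_ h1] := exp_approx (ltn0Sn n) sn.
have B0 : 0 <= B by rewrite (le_trans _ p1B).
rewrite -[_ - _](subrKA (Complex (cos s) (sin s))) [e]splitr toCD.
apply: le_trans (ler_normD _ _) _; apply: lerD.
  apply: le_trans h1 _; rewrite toC_le ler_pdivrMr //.
  apply: (@le_trans _ _ (e / 2 * M)); last by rewrite ler_wpM2l ?divr_ge0 ?ltW.
  apply: (@le_trans _ _ (2 * expR 1 * (A * L ^+ 2) ^+ 2)).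
    by rewrite ler_wpM2l // mulr_ge0 // ltW.
  rewrite /M; set Q := (A * L ^+ 2) ^+ 2.
  have -> : e / 2 * (Q * (1 + 4 * expR 1 / e)) = e / 2 * Q + 2 * expR 1 * Q.
    by field; rewrite gt_eqF.
  by rewrite lerDr mulr_ge0 ?sqr_ge0 // divr_ge0 // ltW.
rewrite /Rhat /expi; set r := 2 * pi * (a * p.1 * p.2).
apply: le_trans (norm_le_RI _) _; rewrite toC_le /=.
have sr : `|s - r| <= e / 4.
  have [x1 x2] := scaled_sin_approx L1 p1B; have [y1 y2] := scaled_sin_approx L1 p2B.
  move: x1 x2 y1 y2; rewrite /s /r.
  set x := L * sin (p.1 / L); set y := L * sin (p.2 / L) => x1 x2 y1 y2.
  have -> : 2 * pi * a * x * y - 2 * pi * (a * p.1 * p.2) =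
      2 * pi * a * ((x - p.1) * y + p.1 * (y - p.2)) by ring.
  rewrite normrM aA.
  apply: (@le_trans _ _ (A * (B ^+ 3 / L * B + B * (B ^+ 3 / L)))).
    rewrite ler_wpM2l // (le_trans (ler_normD _ _)) //.
    rewrite [`|(x - p.1) * y|]normrM [`|p.1 * _|]normrM.
    by apply: lerD; apply: ler_pM => //; exact: le_trans y1 p2B.
  have -> : A * (B ^+ 3 / L * B + B * (B ^+ 3 / L)) = 2 * A * B ^+ 4 / L.
    by field; rewrite gt_eqF.
  rewrite ler_pdivrMr // /L ger0_norm //.
  have -> : e / 4 * (1 + 8 * A * B ^+ 4 / e) = e / 4 + 2 * A * B ^+ 4.
    by field; rewrite gt_eqF.
  by rewrite lerDr divr_ge0 // ltW.
have -> : e / 2 = e / 4 + e / 4 by field.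
by apply: lerD; [apply: le_trans (cos_lipschitz _ _) sr|apply: le_trans (sin_lipschitz _ _) sr].
Qed.
End RhatApproximation.

(** Off a large square F is below e / c and h is at most c; on it h is at most d = e / M, where M
    bounds F. With [star_rep_le] this turns bounded convergence, uniform on squares, into norm
    convergence of phi2(h F). *)
Lemma C0_mul_small (R : realType) (F : R * R -> Cplx R) (c e : R) :
  C0 F -> 0 < c -> 0 < e -> exists (B d : R), 0 < d /\
    forall h : R * R -> Cplx R, (forall p, `|h p| <= toC c) ->
      (forall p, `|p.1| <= B -> `|p.2| <= B -> `|h p| <= toC d) ->
      forall p, `|h p * F p| <= toC e.
Proof.
move=> CF c0 e0; have [M M0 FM] := C0_bounded CF.
have [B B0 FB] := C0_ball CF (divr_gt0 e0 c0).
exists B, (e / M); split=> [|h hc hB p]; first exact: divr_gt0.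
rewrite normrM.
have [pB|] := pselect (`|p.1| <= B /\ `|p.2| <= B).
  rewrite -[e](divfK (lt0r_neq0 M0)) toCM.
  by apply: ler_pM => //; apply: hB; case: pB.
move=> /not_andP pB.
have /ltW Fp : `|F p| < toC (e / c).
  by apply: FB; case: pB => /negP; rewrite -ltNge; [left|right].
rewrite -[e](divfK (lt0r_neq0 c0)) mulrC toCM.
by apply: ler_pM.
Qed.

(** * The intertwining relation for Rhat and the resulting form of iota1 *)

Section IntertwiningRhat.
Variables (R : realType) (H K : hilbert R) (tens : H -> H -> K).
Hypothesis htens : hilbert_tensor tens.
Variable phi : (R -> Cplx R) -> (H -> H).
Hypothesis nphi : nondegenerate_rep phi.
Variable phi2 : (R * R -> Cplx R) -> (K -> K).
Hypothesis tphi2 : tensor_rep tens phi phi2.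
Variables (X : K -> K) (w : H -> H) (U : R -> H -> H) (c : R).
Hypothesis tX : tensor_op tens w id X.
Hypothesis rU : rep_of_C0 phi U.
Hypothesis Uw : forall x v, U x (w v) = expi (- (c * x)) *: w (U x v).
Implicit Types (b F G : R * R -> Cplx R) (f g : R -> Cplx R).

Let rphi : star_rep (@C0 R R) phi := nphi.1.
Let rphi2 : star_rep (@C0 R (R * R)%type) phi2 := tphi2.1.
Let dphi := nondegenerate_range_determining nphi.
Let dphi2 := tensor_rep_range_determining htens nphi tphi2.

(** In the intertwining relation b is always multiplied by F or G in C_0, so convergence in the
    strict topology of the multiplier algebra suffices. *)
Lemma intertwined_lim b (M : R) : bounded_continuous_fun b ->
  (forall e B : R, 0 < e -> exists b', [/\ intertwined phi2 X c b',
     forall p, `|b' p| <= toC M &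
     forall p, `|p.1| <= B -> `|p.2| <= B -> `|b' p - b p| <= toC e]) ->
  intertwined phi2 X c b.
Proof.
move=> cb bapp; split=> // F G x CF CG.
have [_ [D bD]] := cb; have cs := bcf_shift c cb.
pose N := `|M| + `|D| + 1.
have N0 : 0 < N by rewrite ltr_wpDl // addr_ge0.
pose y := X (phi2 G x).
have [L L0 XL] := bounded_op_norm_le (bounded_op_comp (star_rep_bounded rphi2 CF) tX.1).
rewrite /= in XL.
set lhs := phi2 _ _; set rhs := phi2 F _.
have key (e : R) : 0 < e -> `|lhs - rhs| <= toC e * (`|y| + toC L * `|x|).
  move=> e0.
  have [B1 [d1 [d10 H1]]] := C0_mul_small CF N0 e0.
  have [B2 [d2 [d20 H2]]] := C0_mul_small CG N0 e0.
  (* One b' has to serve both sides; on the right it is evaluated at a point translated by c, whence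
     the margin |c|. *)
  have [|b' [ib' b'M b'b]] := bapp (Num.min d1 d2) (Num.max B1 (B2 + `|c|)).
    by rewrite lt_min d10.
  have [cb' ib] := ib'; have cs' := bcf_shift c cb'.
  have dN p : `|b' p - b p| <= toC N.
    rewrite (le_trans (ler_normB _ _)) // (le_trans (lerD (b'M p) (bD p))) //.
    by rewrite -toCD toC_le /N -addrA lerD ?ler_norm // ler_wpDr // ler_norm.
  have C1 := C0_mul cb CF; have C2 := C0_mul cb' CF.
  have C3 := C0_mul cs CG; have C4 := C0_mul cs' CG.
  have e1 : `|phi2 (fun p => b' p * F p) y - lhs| <= toC e * `|y|.
    rewrite /lhs -(star_repB rphi2) //.
    apply: (star_rep_le rphi2) => //.
      have -> : (fun p => b' p * F p - b p * F p) =
        (fun p => -1 * (b p * F p) + b' p * F p) by apply/funext => p; ring.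
      exact: C0_lin.
    move=> p; rewrite -mulrBl; apply: (H1 (fun p => b' p - b p)) => [q|q q1 q2]; first exact: dN.
    apply: le_trans (b'b q _ _) _; rewrite ?le_max ?q1 ?q2 //.
    by rewrite toC_le ge_min lexx.
  have e2 : `|phi2 (fun p => shift_fst c b' p * G p) x - phi2 (fun p => shift_fst c b p * G p) x|
      <= toC e * `|x|.
    rewrite -(star_repB rphi2) //.
    apply: (star_rep_le rphi2) => //.
      have -> : (fun p => shift_fst c b' p * G p - shift_fst c b p * G p) =
        (fun p => -1 * (shift_fst c b p * G p) + shift_fst c b' p * G p).
        by apply/funext => p; ring.
      exact: C0_lin.
    move=> p; rewrite -mulrBl.
    apply: (H2 (fun p => shift_fst c b' p - shift_fst c b p)) => [q|q q1 q2]; first exact: dN.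
    apply: le_trans (b'b _ _ _) _ => /=; rewrite ?le_max.
    - apply/orP; right; rewrite (le_trans (ler_normD _ _)) // lerD2r //.
    - by apply/orP; right; rewrite ler_wpDr.
    - by rewrite toC_le ge_min lexx orbT.
  (* The middle terms, with b' in place of b, agree because b' is intertwined. *)
  have -> : lhs - rhs = - (phi2 (fun p => b' p * F p) y - lhs) +
      phi2 F (X (phi2 (fun p => shift_fst c b' p * G p) x -
                 phi2 (fun p => shift_fst c b p * G p) x)).
    rewrite (linear_mapB tX.1.1) (linear_mapB (star_rep_bounded rphi2 CF).1).
    by rewrite -ib // opprB subrKA.
  rewrite (le_trans (ler_normD _ _)) // normrN mulrDr lerD //.
  by rewrite (le_trans (XL _)) // mulrCA ler_wpM2l // -toC0 toC_le ltW.
apply/eqP; rewrite -subr_eq0 -normr_eq0; apply/negPn/negP => n0.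
have /gt0_toC[d d0 dE] : 0 < `|lhs - rhs| by rewrite lt_neqAle eq_sym n0 normr_ge0.
have m0 : 0 <= `|y| + toC L * `|x|.
  by rewrite addr_ge0 // mulr_ge0 // -toC0 toC_le ltW.
have mE := ge0_toC m0; move: key m0; rewrite dE mE -toC0 toC_le.
move: (Rpart _) => m key m0; have m1 : 0 < m + 1 by rewrite ltr_wpDl.
have := key (d / (2 * (m + 1))) _; rewrite divr_gt0 ?mulr_gt0 // => /(_ isT).
rewrite -toCM toC_le leNgt => /negP; apply.
rewrite mulrAC ltr_pdivrMr ?mulr_gt0 //; nra.
Qed.

(** Euler's formula: y = 1 / (2 pi L) gives <xi, y> = e^(i xi / L), and L sin(xi / L) combines the
    characters at y and -y with coefficients iL/2 and -iL/2. *)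
Lemma intertwined_sin (L : R) : 0 < L ->
  intertwined phi2 X c (fun p => toC (L * sin (p.1 / L))).
Proof.
move=> L0; pose y := (2 * pi * L)^-1.
have ic x := intertwined_character htens nphi tphi2 tX rU Uw x.
have iz z x := intertwined_lin tphi2 tX z (ic x) (intertwined_cst htens nphi tphi2 c tX 0).
have := intertwined_lin tphi2 tX (Complex 0 (- L / 2)) (ic (- y))
  (iz (Complex 0 (L / 2)) y).
congr (intertwined phi2 X c _); apply/funext => p.
have e x : 2 * pi * (x * y) = x / L.
  rewrite /y; have := lt0r_neq0 (pi_gt0 R); move: (pi : R) => P P0.
  by field; rewrite P0 lt0r_neq0.
apply: CplxP; rewrite !(RpartD, RpartM, IpartD, IpartM, Rpart_conj, Ipart_conj) /=.
  by rewrite !mulrN cosN sinN e; field.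
by rewrite !mulrN cosN sinN e; field.
Qed.

Lemma bcf_Rhat (a : R) : bounded_continuous_fun (Rhat a).
Proof.
apply: (@bcf_expi _ _ (fun p : R * R => a * p.1 * p.2)) => p.
apply: cvgM; last exact: cvg_snd.
by apply: cvgM; [exact: cvg_cst|exact: cvg_fst].
Qed.

(** The approximants are powers of 1 + i s / n, where s is a multiple of the product of a sine in xi
    and a sine in eta; each is built from relations already known. *)
Lemma intertwined_Rhat (a : R) : intertwined phi2 X c (Rhat a).
Proof.
apply: (intertwined_lim (M := expR 1)) => [|e B e0]; first exact: bcf_Rhat.
have [L [n [L0 bM be]]] := Rhat_approx a B e0.
eexists; split; [|exact: bM|exact: be].
apply: (intertwined_exp htens nphi tphi2 tX n).
have is1 := intertwined_sin L0.
have bs : bounded_continuous_fun (fun t : R => toC (L * sin (t / L))).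
  split.
    apply: continuous_Complex; last by move=> x; exact: cvg_cst.
    move=> x; apply: cvgM; first exact: cvg_cst.
    by apply: continuous_comp; [exact: mulrr_continuous|exact: continuous_sin].
  exists `|L| => t; rewrite norm_toC toC_le normrM ler_piMr // sin_max //.
have is2 := intertwined_snd htens nphi tphi2 c tX bs.
have := intertwined_lin tphi2 tX (Complex 0 (2 * pi * a / n%:R))
  (intertwined_mul is1 is2) (intertwined_cst htens nphi tphi2 c tX 1).
congr (intertwined phi2 X c _); apply/funext => p.
by apply: CplxP; rewrite ?(RpartD, RpartM, IpartD, IpartM) /=; ring.
Qed.

Variables (a : R) (Rop Rst : K -> K).
Hypothesis hRop : multiplier_value phi2 (Rhat a) Rop.
Hypothesis bRst : bounded_op Rst.
Hypothesis aRst : is_adjoint Rop Rst.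

Hypothesis bw : bounded_op w.

(** Under a test operator phi2(f (x) g) on the left, [Rop] is absorbed as the function Rhat, and the
    intertwining relation moves it past [X]. *)
Lemma Rop_range G z : C0 G ->
  Rop (X (phi2 G z)) = X (phi2 (fun p => shift_fst c (Rhat a) p * G p) z).
Proof.
move=> CG; apply: (tensor_rep_inj htens nphi tphi2) => f g Cf Cg.
have CF := C0_tensf Cf Cg; have [cR iR] := intertwined_Rhat a.
by rewrite -iR // -(multiplier_value_left rphi2 dphi2 _ hRop).
Qed.

(* Rop (w (x) 1) Rop^* = w (x) U_(-ca), because Rhat (xi + c, eta) is
   e^(2 pi i c a eta) Rhat (xi, eta). *)
Lemma braided_left_tens u v :
  Rop (X (Rst (tens u v))) = tens (w u) (U (- (c * a)) v).
Proof.
have bU := (rU (- (c * a))).1; have bT := bounded_op_comp hRop.1 (bounded_op_comp tX.1 bRst).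
have elem f g u' v' : C0 f -> C0 g ->
    Rop (X (Rst (tens (phi f u') (phi g v')))) =
    tens (w (phi f u')) (U (- (c * a)) (phi g v')).
  move=> Cf Cg; have Ct := C0_tensf Cf Cg; have cp := bcf_pairing (- (c * a)).
  have cR := bcf_Rhat a.
  rewrite -(tensor_repE tphi2) // (multiplier_value_adjoint rphi2 dphi2 _ hRop) //.
  rewrite Rop_range; last exact: C0_mul (bcf_conj cR) Ct.
  have -> : (fun p => shift_fst c (Rhat a) p * (Num.conj (Rhat a p) * tensf f g p)) =
      tensf f (fun t => Num.conj (pairing t (- (c * a))) * g t).
    apply/funext => p; rewrite /tensf /shift_fst /Rhat /pairing /=.
    have -> : a * (p.1 + c) * p.2 = p.2 * (c * a) + a * p.1 * p.2 by ring.
    rewrite expiD mulrN expiN conjCK; set x := expi (a * _ * _).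
    have := expiJM (a * p.1 * p.2); rewrite -/x => xJ.
    transitivity (Num.conj x * x * (f p.1 * (expi (p.2 * (c * a)) * g p.2))); first by ring.
    by rewrite xJ mul1r.
  rewrite (tensor_repE tphi2) //; last exact: C0_mul.
  by rewrite tX.2 -(multiplier_value_range _ (rU _)).
have lcl (S : H -> H) y : bounded_op S ->
    linear (fun z => tens (S z) y) /\ continuous (fun z => tens (S z) y).
  move=> [lS cS]; split=> [k x x'|x]; first by rewrite lS (tens_linearl htens).
  by apply: (@continuous_comp _ _ _ S (tens^~ y)); [exact: cS|exact: (tens_continuousl htens)].
have lcr (S : H -> H) y : bounded_op S ->
    linear (fun z => tens y (S z)) /\ continuous (fun z => tens y (S z)).
  move=> [lS cS]; split=> [k x x'|x]; first by rewrite lS (tens_linearr htens).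
  by apply: (@continuous_comp _ _ _ S (tens y)); [exact: cS|exact: (tens_continuousr htens)].
have bid := @bounded_op_id R H.
have lcT (S : H -> K) : linear S /\ continuous S -> linear (fun z : H => Rop (X (Rst (S z)))) /\
    continuous (fun z : H => Rop (X (Rst (S z)))).
  move=> [lS cS]; split=> [k x x'|x]; first by rewrite lS; exact: bT.1.
  apply: (@continuous_comp _ _ _ S (fun z => Rop (X (Rst z)))); first exact: cS.
  exact: bT.2.
have [l1 c1] := lcT _ (lcr id u bid).
have [l2 c2] := lcr _ (w u) bU.
move: v; apply: (dphi l1 c1 l2 c2) => g v' Cg.
have [l3 c3] := lcT _ (lcl id (phi g v') bid).
have [l4 c4] := lcl _ (U (- (c * a)) (phi g v')) bw.
move: u {l1 c1 l2 c2}; apply: (dphi l3 c3 l4 c4) => f u' Cf.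
exact: elem.
Qed.
End IntertwiningRhat.

(** * Arcs of the circle *)

Section CircleScalars.
Variable R : realType.
Implicit Types (t d : R) (k n : nat).

Lemma expi1 : expi (1 : R) = 1.
Proof. by rewrite /expi mulr1 mulr_natl sin2pi cos2pi. Qed.

Lemma expi_int (z : int) : expi (z%:~R : R) = 1.
Proof.
case: z => k; last rewrite NegzE mulrNz expiN.
  by rewrite -[_%:~R]mul1r -expiX expi1 expr1n.
by rewrite -[_%:~R]mul1r -expiX expi1 expr1n conjC1.
Qed.

Lemma cos_2pi t : 1 - cos (2 * pi * t) = 2 * sin (pi * t) ^+ 2.
Proof. by rewrite one_sub_cos; congr (2 * sin _ ^+ 2); field. Qed.

(** For the fractional part f of t the hypothesis gives sin(pi f) = 0, whereas sin(pi f) > 0 if 0 <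
    f < 1. *)
Lemma cos_2pi_eq1 t : cos (2 * pi * t) = 1 -> exists z : int, t = z%:~R.
Proof.
move=> t1; exists (Num.floor t); pose f := t - (Num.floor t)%:~R.
have f1 : cos (2 * pi * f) = 1.
  have : expi f = expi t by rewrite expiD expiN expi_int conjC1 mulr1.
  by move=> /(congr1 (@Rpart R)) /= ->.
have /andP[f0 fl1] : 0 <= f < 1.
  have /andP[a b] := floor_itv t.
  by rewrite subr_ge0 a /= ltrBlDl -[X in _ + X]/(1%:~R) -intrD.
have := cos_2pi f; rewrite f1 subrr => /esym/eqP.
rewrite mulf_eq0 pnatr_eq0 expf_eq0 /= => /eqP s0.
have [f_gt0|f_le0] := ltP 0 f.
  have : 0 < sin (pi * f).
    by apply: sin_gt0_pi; rewrite mulr_gt0 ?pi_gt0 //= gtr_pMr ?pi_gt0.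
  by rewrite s0 ltxx.
by apply/eqP; rewrite -subr_eq0 -/f eq_le f_le0 f0.
Qed.

(** Finitely many numbers 1 - cos(2 pi k a), all positive since ka is not an integer, have a
    positive lower bound. The factor 4 is the one of [cos_arc_disjoint]. *)
Lemma irrational_gap (a : R) n : irrational a -> exists2 d : R, 0 < d &
  forall k, (0 < k < n)%N -> 4 * d <= 1 - cos (2 * pi * (k%:R * a)).
Proof.
move=> ia; elim: n => [|n [d d0 H]].
  by exists 1 => // k; rewrite ltn0 andbF.
have [n0|n0] := posnP n.
  by exists 1 => // k; rewrite n0 ltnS leqn0; case: k.
pose e := (1 - cos (2 * pi * (n%:R * a))) / 4.
have e0 : 0 < e.
  rewrite divr_gt0 // lt_neqAle subr_ge0 cos_le1 andbT eq_sym subr_eq0.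
  apply/eqP => /esym/cos_2pi_eq1[z za]; apply: ia => /=.
  exists (z%:~R / n%:R) => //; rewrite fmorph_div /= ratr_int ratr_nat -za.
  by rewrite mulrAC mulfV ?mul1r // pnatr_eq0 -lt0n.
exists (Num.min d e) => [|k /andP[k0]]; first by rewrite lt_min d0.
rewrite ltnS leq_eqVlt => /predU1P[->|kn].
  have : Num.min d e <= e by rewrite ge_min lexx orbT.
  by rewrite /e; lra.
have : Num.min d e <= d by rewrite ge_min lexx.
by have := H k; rewrite k0 kn => /(_ isT); lra.
Qed.

(** Since 1 - cos(2 pi z) = 2 sin(pi z)^2, both hypotheses bound a squared sine by d / 2, and sin(A
    - B)^2 <= 2 (sin(A)^2 + sin(B)^2). *)
Lemma cos_arc_disjoint d t (x y : R) :
  1 - d < cos (2 * pi * (t + x)) -> 1 - d < cos (2 * pi * (t + y)) ->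
  1 - cos (2 * pi * (x - y)) < 4 * d.
Proof.
have e z : 1 - d < cos (2 * pi * z) -> sin (pi * z) ^+ 2 < d / 2.
  by have := cos_2pi z; move: (cos _) (sin _) => C S; nra.
move=> /e A /e B; rewrite cos_2pi.
have -> : pi * (x - y) = pi * (t + x) - pi * (t + y) by ring.
rewrite sinB; have := cos2Dsin2 (pi * (t + y)); have := cos2Dsin2 (pi * (t + x)).
move: A B; move: (sin _) (cos _) (sin _) (cos _) => s c s' c'.
move=> A B e2 e1.
suff : (s * c' - c * s') ^+ 2 <= 2 * (s ^+ 2 + s' ^+ 2) by lra.
have : (s * c' - c * s') ^+ 2 + (s * c' + c * s') ^+ 2 =
  2 * (s ^+ 2 * c' ^+ 2 + c ^+ 2 * s' ^+ 2) by ring.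
have c1 : c ^+ 2 <= 1 by rewrite -e1 lerDl sqr_ge0.
have c2 : c' ^+ 2 <= 1 by rewrite -e2 lerDl sqr_ge0.
have := sqr_ge0 (s * c' + c * s').
have h1 : s ^+ 2 * c' ^+ 2 <= s ^+ 2 by rewrite ler_piMr ?sqr_ge0.
have h2 : c ^+ 2 * s' ^+ 2 <= s' ^+ 2 by rewrite ler_piMl ?sqr_ge0.
lra.
Qed.

End CircleScalars.

Section CircleFunctions.
Variable R : realType.
Implicit Types (t d : R) (k n : nat) (f g : Cplx R -> Cplx R).

Lemma Linfty_circle_continuous f (c : R) :
  continuous (fun t : R => f (expi t)) -> (forall t, `|f (expi t)| <= toC c) ->
  Linfty_circle f.
Proof.
move=> cf fc; split.
- apply: measurable_realfun.continuous_measurable_fun => t.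
  by apply: cvg_Rpart; exact: cf.
- apply: measurable_realfun.continuous_measurable_fun => t.
  by apply: cvg_Ipart; exact: cf.
- by exists c; apply: aeW.
Qed.

Lemma Linfty_circle_expi f (m : R) : (forall t, f (expi t) = expi (t * m)) ->
  Linfty_circle f.
Proof.
move=> fm; have e : (fun t : R => f (expi t)) = (fun t => expi (t * m)).
  exact/funext.
apply: (Linfty_circle_continuous (c := 1)) => [|t].
  rewrite e => t; apply: (@continuous_comp _ _ _ (fun t => t * m) (@expi R)).
    exact: mulrr_continuous.
  exact: expi_continuous.
by rewrite fm expi_norm.
Qed.

Lemma eq_circle_int f g : (forall t, f (expi t) = g (expi t)) ->
  circle_int f = circle_int g.
Proof.
move=> fg; rewrite /circle_int.
by congr Complex; apply: eq_Rintegral => t _; rewrite fg.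
Qed.

(** The antiderivatives sin(wt) / w and -cos(wt) / w with w = 2 pi n agree at 0 and 1. *)
Lemma circle_int_expi f n : (0 < n)%N ->
  (forall t, f (expi t) = expi (t * n%:R)) -> circle_int f = 0.
Proof.
move=> n0 fn.
pose w : R := 2 * pi * n%:R.
have w0 : w != 0 by rewrite /w !mulf_neq0 ?pnatr_eq0 -?lt0n // gt_eqF ?pi_gt0.
have ww t : 2 * pi * (t * n%:R) = w * t by rewrite /w; ring.
have int0 (g G : R -> R) : continuous g ->
    (forall t : R, is_derive t 1 G (w * g t)) -> G 1 = G 0 ->
    \int[lebesgue_measure]_(t in `[0, 1]) g t = 0.
  move=> cg Gd G10.
  have fd (t : R) : is_derive t 1 (w^-1 \*: (G : R -> R^o)) (g t).
    have := is_deriveZ w^-1 (Gd t).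
    by rewrite /GRing.scale /= mulKf.
  rewrite /Rintegral (@continuous_FTC2 R g (w^-1 \*: (G : R -> R^o)) 0 1) //.
  - by rewrite /= G10 subrr.
  - exact: continuous_subspaceT.
  - have cG : continuous (w^-1 \*: (G : R -> R^o)).
      by move=> t; apply/differentiable_continuous/derivable1_diffP; case: (fd t).
    split; first by move=> t _; case: (fd t).
      by apply: cvg_at_right_filter; exact: cG.
    by apply: cvg_at_left_filter; exact: cG.
  - by move=> t _; rewrite derive1E; apply: derive_val.
have [cosw sinw] : cos w = 1 /\ sin w = 0.
  have := expi_int R n; rewrite /expi /intmul => -[].
  by rewrite -/w.
have dw t : is_derive t 1 (fun t => w * t) w.
  by have := is_deriveZ w (is_derive_id t 1); rewrite /GRing.scale /= mulr1.
rewrite /circle_int; apply: CplxP => /=.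
- transitivity (\int[lebesgue_measure]_(t in `[0, 1]) cos (w * t)).
    by apply: eq_Rintegral => t _; rewrite fn /= ww.
  apply: (int0 _ (fun t => sin (w * t))); last by rewrite mulr1 mulr0 sin0.
    move=> t; apply: (@continuous_comp _ _ _ (fun t => w * t) cos).
      exact: mulrl_continuous.
    exact: continuous_cos.
  move=> t; have := is_derive1_comp (is_derive_sin (w * t)) (dw t).
  by rewrite mulrC.
- transitivity (\int[lebesgue_measure]_(t in `[0, 1]) sin (w * t)).
    by apply: eq_Rintegral => t _; rewrite fn /= ww.
  apply: (int0 _ (fun t => - cos (w * t))); last by rewrite mulr1 mulr0 cos0 cosw.
    move=> t; apply: (@continuous_comp _ _ _ (fun t => w * t) sin).
      exact: mulrl_continuous.
    exact: continuous_sin.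
  move=> t; have := is_deriveN (is_derive1_comp (is_derive_cos (w * t)) (dw t)).
  by rewrite mulNr opprK mulrC.
Qed.

Lemma circle_int1 f : (forall t, f (expi t) = 1) -> circle_int f = 1.
Proof.
move=> f1; rewrite (eq_circle_int (g := fun _ => 1)) // /circle_int /Rintegral.
apply: CplxP => /=.
  have m01 : @lebesgue_measure R `[0, 1]%classic = 1%E.
    by rewrite lebesgue_measure_itv /= lte_fin ltr01 sube0.
  by rewrite integral_cst // mul1e; exact: (congr1 fine m01).
by rewrite integral_cst // mul0e.
Qed.

(** Cutting out the arc around 1 by the real part avoids arguments of complex numbers: along t |->
    e^(2 pi i t) it is a condition on a cosine, and rotation translates t. *)
Definition arc_ind d : Cplx R -> Cplx R := fun z => toC (1 - d < Rpart z)%R%:R.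

Lemma arc_conj d z : Num.conj (arc_ind d z) = arc_ind d z.
Proof. exact: conj_toC. Qed.

Lemma arc_idem d z : arc_ind d z * arc_ind d z = arc_ind d z.
Proof. by rewrite /arc_ind; case: (_ < _); rewrite -toCM ?mulr1 ?mulr0. Qed.

Definition arc_set d := [set t : R | 1 - d < cos (2 * pi * t)].

Lemma measurable_arc_set d : measurable (arc_set d).
Proof.
rewrite -[X in measurable X]setTI.
have mc : measurable_fun setT (fun t : R => cos (2 * pi * t)).
  apply: measurable_realfun.continuous_measurable_fun => t.
  apply: (@continuous_comp _ _ _ (fun t => 2 * pi * t) cos).
    exact: mulrl_continuous.
  exact: continuous_cos.
have := mc measurableT `]1 - d, +oo[%classic (measurable_itv _).
congr (measurable (_ `&` _)); apply/seteqP; split=> t /=;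
  by rewrite in_itv /= andbT.
Qed.

Lemma Rpart_arc d : (fun t : R => Rpart (arc_ind d (expi t))) = \1_(arc_set d).
Proof.
apply/funext => t; rewrite indicE /arc_ind /=; congr (_%:R); congr nat_of_bool.
by apply/idP/idP; rewrite inE.
Qed.

Lemma Linfty_circle_arc d : Linfty_circle (arc_ind d).
Proof.
split.
- rewrite Rpart_arc; apply: measurable_realfun.measurable_indic.
  exact: measurable_arc_set.
- exact: measurable_cst.
- exists 1; apply: aeW => t; rewrite norm_toC toC_le normr_nat.
  by case: (_ < _).
Qed.

Lemma circle_int_arc d : 0 < d -> exists2 e : R, 0 < e & circle_int (arc_ind d) = toC e.
Proof.
move=> d0; pose S := arc_set d `&` `[0, 1]%classic; pose m := fine (@lebesgue_measure R S).
have mAI : measurable S.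
  by apply: measurableI => //; exact: measurable_arc_set.
have mE : circle_int (arc_ind d) = toC m.
  rewrite /circle_int Rpart_arc; apply: CplxP => /=.
    rewrite /Rintegral integral_indic //; exact: measurable_arc_set.
  by rewrite /Rintegral integral_cst // mul0e.
exists m => //.
(* For 0 <= t <= e one has 1 - cos(2 pi t) <= 2 pi t <= d / 2 < d, so the arc has measure at least
   e. *)
pose e := Num.min 1 (d / (4 * pi)).
have pi0 := pi_gt0 R.
have e0 : 0 < e by rewrite lt_min ltr01 divr_gt0 // mulr_gt0.
have sub : `[0, e]%classic `<=` S.
  move=> t /=; rewrite !in_itv /= => /andP[t0 te]; split; last first.
    by rewrite /= in_itv /= t0 (le_trans te) // ge_min lexx.
  rewrite /arc_set /= ltrBlDr -ltrBlDl.
  have te' : t <= d / (4 * pi) by rewrite (le_trans te) // ge_min lexx orbT.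
  have := cos_lipschitz 0 (2 * pi * t); rewrite cos0 sub0r normrN.
  rewrite [`|2 * pi * t|]ger0_norm ?mulr_ge0 ?(ltW pi0) //.
  move=> /(le_trans (ler_norm _)) /le_lt_trans; apply.
  move: te'; rewrite ler_pdivlMr ?mulr_gt0 //; move: (pi : R) pi0 => P P0; nra.
have m1 : (@lebesgue_measure R S <= 1)%E.
  apply: (@le_trans _ _ (@lebesgue_measure R `[0, 1]%classic)).
    by apply: le_measure; rewrite ?inE //; exact: subIsetr.
  by rewrite lebesgue_measure_itv /= lte_fin ltr01 sube0.
have : (e%:E <= @lebesgue_measure R S)%E.
  apply: (@le_trans _ _ (@lebesgue_measure R `[0, e]%classic)).
    by rewrite lebesgue_measure_itv /= lte_fin e0 sube0.
  by apply: le_measure; rewrite ?inE.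
move=> em; rewrite (lt_le_trans e0) // -lee_fin fineK // ge0_fin_numE //.
exact: le_lt_trans m1 (ltry _).
Qed.
End CircleFunctions.

(** * Vectors and normal functionals *)

Section Series.
Variable R : realType.
Implicit Types u : nat -> Cplx R.

Lemma Rpart_series u n : Rpart (series u n) = series (fun k => Rpart (u k)) n.
Proof. by rewrite /series /=; apply: big_morph; [exact: RpartD|]. Qed.

Lemma Ipart_series u n : Ipart (series u n) = series (fun k => Ipart (u k)) n.
Proof. by rewrite /series /=; apply: big_morph; [exact: IpartD|]. Qed.

Lemma cvg_series_Cplx u (x y : R) :
  series (fun k => Rpart (u k)) @ \oo --> x ->
  series (fun k => Ipart (u k)) @ \oo --> y ->
  series u @ \oo --> (Complex x y : Cplx R).
Proof.
move=> ux uy; have -> : series u = (fun n => Complex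
    (series (fun k => Rpart (u k)) n) (series (fun k => Ipart (u k)) n)).
  by apply/funext => n; apply: CplxP; rewrite ?Rpart_series ?Ipart_series.
exact: cvg_Complex.
Qed.

Lemma geometric_series_cvg (f : nat -> R) (c : R) :
  (forall n, `|f n| <= c * 4^-1 ^+ n) -> cvgn (series f).
Proof.
move=> fc; apply: normed_cvg.
have g4 : `|4^-1 : R| < 1 by rewrite ger0_norm ?invf_lt1 ?ltr1n.
apply: (series_le_cvg (v_ := geometric c 4^-1)) => //.
- by move=> n; rewrite /= normr_ge0.
- by move=> n; exact: le_trans (normr_ge0 _) (fc n).
- exact: is_cvg_geometric_series.
Qed.

Variable H : hilbert R.

(** omega(T) is the sum of 4^(-n) <T v_n, v_n>, obtained from the vectors 2^(-n) v_n in both slots.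
    When all terms are nonnegative, each single one bounds omega(T) from below. *)
Lemma geometric_normal_functional (A : set (H -> H)) (v : nat -> H) :
  A `<=` @bounded_op R H -> (forall n, `|v n| = 1) ->
  exists2 omega : (H -> H) -> Cplx R, normal_functional A omega &
    forall T (r : nat -> R), A T -> (forall n, hdot (T (v n)) (v n) = toC (r n)) ->
      (forall n, 0 <= r n) ->
      exists2 s : R, omega T = toC s & forall n, 4^-1 ^+ n * r n <= s.
Proof.
move=> Ab v1; pose xi n := toC (2^-1 ^+ n) *: v n.
have pw n : (2^-1 ^+ n * 2^-1 ^+ n : R) = 4^-1 ^+ n.
  by rewrite -exprMn; congr (_ ^+ n); field.
have xiE T n : bounded_op T ->
    hdot (T (xi n)) (xi n) = toC (4^-1 ^+ n) * hdot (T (v n)) (v n).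
  move=> [lT _]; rewrite /xi (linear_mapZ lT) hdotZl hdotZr conj_toC mulrA.
  by rewrite -toCM pw.
have xi2 n : `|xi n| ^+ 2 = toC (4^-1 ^+ n).
  rewrite hdotE (xiE id) ?bounded_op_id //; last exact: bounded_op_id.
  by rewrite -hdotE v1 expr1n mulr1.
have cxi : cvgn (series (fun n => `|xi n| ^+ 2)).
  have c1 : cvgn (series (fun n => Rpart (`|xi n| ^+ 2))).
    apply: (geometric_series_cvg (c := 1)) => n.
    by rewrite xi2 /= mul1r ger0_norm // exprn_ge0 // invr_ge0.
  have c2 : cvgn (series (fun n => Ipart (`|xi n| ^+ 2))).
    apply: (geometric_series_cvg (c := 0)) => n.
    by rewrite xi2 /= normr0 mul0r.
  by apply/cvg_ex; eexists; apply: cvg_series_Cplx c1 c2.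
pose t T n := hdot (T (xi n)) (xi n).
have ct T : A T -> cvgn (series (fun n => Rpart (t T n))) /\
    cvgn (series (fun n => Ipart (t T n))).
  move=> /Ab bT; have [L L0 TL] := bounded_op_norm_le bT.
  have tn n : `|t T n| <= toC (L * 4^-1 ^+ n).
    rewrite /t (xiE T) // normrM norm_toC [`|4^-1 ^+ n|]ger0_norm ?exprn_ge0 ?invr_ge0 //.
    rewrite toCM [leLHS]mulrC; apply: ler_wpM2r.
      by rewrite -toC0 toC_le exprn_ge0 // invr_ge0.
    rewrite (le_trans (Cauchy_Schwarz _ _)) // v1 mulr1 (le_trans (TL _)) //.
    by rewrite v1 mulr1.
  split; apply: (geometric_series_cvg (c := L)) => n; rewrite -toC_le.
  - exact: le_trans (Rpart_le_norm _) (tn n).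
  - exact: le_trans (Ipart_le_norm _) (tn n).
exists (fun T => Complex (limn (series (fun n => Rpart (t T n))))
                         (limn (series (fun n => Ipart (t T n))))).
  exists xi, xi; split; [exact: cxi|exact: cxi|move=> T /ct[c1 c2]].
  exact: cvg_series_Cplx c1 c2.
move=> T r AT Tr r0; have [c1 _] := ct T AT.
have tr n : t T n = toC (4^-1 ^+ n * r n).
  by rewrite /t (xiE T) ?Tr ?toCM //; exact: Ab.
exists (limn (series (fun n => Rpart (t T n)))).
  rewrite /toC; congr Complex.
  have -> : (fun n => Ipart (t T n)) = (fun _ => 0).
    by apply/funext => n; rewrite tr.
  rewrite (_ : series _ = fun _ => 0) ?lim_cst //.
  by apply/funext => n; rewrite /series /= big1.
move=> n; have p k : 0 <= Rpart (t T k).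
  by rewrite tr /= mulr_ge0 // exprn_ge0 // invr_ge0.
have ndc : nondecreasing_seq (series (fun n => Rpart (t T n))).
  by apply: nondecreasing_series => k _ _.
apply: le_trans (nondecreasing_cvgn_le ndc c1 n.+1).
rewrite seriesEnat /= big_nat_recr //= tr /= lerDr.
by apply: sumr_ge0 => k _.
Qed.

End Series.

Section GNSVectors.
Variables (R : realType) (I : choiceType) (H : hilbert R) (Omega : H).
Variable j : I -> (Cplx R -> Cplx R) -> (H -> H).
Hypothesis hj : product_state_gns Omega j.
Variable i : I.
Implicit Types (f g : Cplx R -> Cplx R) (k m : nat).

Definition mono k : Cplx R -> Cplx R := fun z => z ^+ k.

Lemma Linfty_circle_mono k : Linfty_circle (mono k).
Proof. by apply: (Linfty_circle_expi (m := k%:R)) => t; exact: expiX. Qed.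

Lemma conj_expi_mono k t : Num.conj (mono k (expi t)) = expi (- (t * k%:R)).
Proof. by rewrite /mono expiX expiN. Qed.

Lemma Linfty_circle_conj f : Linfty_circle f ->
  Linfty_circle (fun z => Num.conj (f z)).
Proof.
move=> [mr mi [c fc]]; split.
- rewrite (_ : (fun t => _) = (fun t => Rpart (f (expi t)))) //.
  by apply/funext => t; rewrite Rpart_conj.
- rewrite (_ : (fun t => _) = (fun t => - Ipart (f (expi t)))).
    exact: measurableT_comp.
  by apply/funext => t; rewrite Ipart_conj.
- exists c; move: fc; congr (nbhs _ _).
  by apply/funext => t; rewrite norm_conjC.
Qed.

Lemma gns_state1 f : Linfty_circle f -> hdot (j i f Omega) Omega = circle_int f.
Proof.
move=> Lf; have := gns_state hj (s := [:: i]) (f := fun _ => f) isT (fun _ => Lf).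
by rewrite /elementary_tensor big_cons big_nil /= big_seq1.
Qed.

Lemma gns_dot f g : Linfty_circle f -> Linfty_circle g ->
  Linfty_circle (fun z => Num.conj (g z) * f z) ->
  hdot (j i f Omega) (j i g Omega) = circle_int (fun z => Num.conj (g z) * f z).
Proof.
move=> Lf Lg Lgf; have rj := gns_rep hj i.
rewrite -gns_state1 // hdotC (star_rep_adj rj Lg) -hdotC.
by rewrite (star_rep_mul rj (Linfty_circle_conj Lg) Lf).
Qed.

Lemma gns_mono0 : j i (mono 0) = id.
Proof.
by rewrite -(gns_unital hj i); congr (j i _); apply/funext => z; exact: expr0.
Qed.

Lemma gns_mono_dot k m :
  hdot (j i (mono k) Omega) (j i (mono m) Omega) = (k == m)%:R.
Proof.
(* [circle_int_expi] treats positive frequencies; the negative ones follow by Hermitian symmetry. *)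
wlog km : k m / (m <= k)%N.
  move=> h; have [/h//|/ltnW/h e] := leqP m k.
  by rewrite hdotC e conjC_nat eq_sym.
have e t : Num.conj (mono m (expi t)) * mono k (expi t) = expi (t * (k - m)%:R).
  by rewrite conj_expi_mono /mono expiX -expiD natrB //; congr expi; ring.
rewrite gns_dot; last exact: (Linfty_circle_expi e); try exact: Linfty_circle_mono.
have [->|nkm] := eqVneq k m.
  by rewrite circle_int1 // => t; rewrite conj_expi_mono /mono expiX -expiD addNr expi0.
by apply: circle_int_expi e; rewrite subn_gt0 ltn_neqAle eq_sym nkm.
Qed.

(* The value <u^k v, v> for v = m^(-1/2) sum_(a < m) u^a Omega, where u is the
   coordinate function. *)
Definition fejer_coef k m : R :=
  (\sum_(a < m) \sum_(b < m) (k + a == b)%N)%:R / m%:R.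

Lemma fejer_coef_ge0 k m : 0 <= fejer_coef k m.
Proof. by rewrite divr_ge0. Qed.

(** For k < m each of the first m of the 2m indices still lies below 2m after adding k, so at least
    half of the terms survive. This is why the order is twice the number of powers in use. *)
Lemma fejer_coef_ge k m : (k < m)%N -> 2^-1 <= fejer_coef k (m + m).
Proof.
move=> km; have m0 : 0 < m%:R :> R by rewrite ltr0n (leq_ltn_trans _ km).
rewrite /fejer_coef ler_pdivlMr ?natrD ?addr_gt0 //.
have -> : 2^-1 * (m%:R + m%:R) = m%:R :> R by field.
rewrite ler_nat big_split_ord /= -[leqLHS]addn0 leq_add //.
rewrite -[leqLHS]card_ord -sum1_card leq_sum // => a _.
have kam : (k + a < m + m)%N by rewrite -addSn leq_add // ltnW.
by rewrite (bigD1 (Ordinal kam)) //= eqxx.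
Qed.

Lemma gns_fejer_vector m : (0 < m)%N -> exists2 v : H, `|v| = 1 &
  forall k, hdot (j i (mono k) v) v = toC (fejer_coef k m).
Proof.
move=> m0; have mR : 0 < m%:R :> R by rewrite ltr0n.
pose s : R := (Num.sqrt m%:R)^-1.
have s2 : s * s = m%:R^-1.
  by rewrite /s -invfM -expr2 sqr_sqrtr // ltW.
pose v := toC s *: \sum_(a < m) j i (mono a) Omega.
have vk k : hdot (j i (mono k) v) v = toC (fejer_coef k m).
  have [lk _] := star_rep_bounded (gns_rep hj i) (Linfty_circle_mono k).
  rewrite /v (linear_mapZ lk) (linear_map_sum lk) hdotZl hdotZr conj_toC mulrA.
  rewrite -toCM s2 hdot_suml /fejer_coef mulrC toCM toC_nat natr_sum; congr (_ * _).
  apply: eq_bigr => a _; rewrite hdot_sumr natr_sum; apply: eq_bigr => b _.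
  rewrite -gns_mono_dot; congr (hdot _ _).
  have := star_rep_mul (gns_rep hj i) (Linfty_circle_mono k) (Linfty_circle_mono a).
  move=> /(congr1 (@^~ Omega)) /= <-; congr (j i _ _).
  by apply/funext => z; rewrite /mono exprD.
(* The norm is the case k = 0, where the double sum counts the diagonal. *)
exists v => //; apply/eqP; rewrite -(eqrXn2 (n := 2)) // expr1n hdotE.
have := vk 0; rewrite gns_mono0 => ->.
rewrite /fejer_coef (_ : (\sum_(a < m) \sum_(b < m) (0 + a == b)%N)%N = m).
  by rewrite divff // gt_eqF.
rewrite -[RHS]card_ord -sum1_card; apply: eq_bigr => a _.
rewrite (bigD1 a) //= eqxx big1 // => b ba.
by rewrite eq_sym (_ : (val b == val a) = (b == a)) // (negbTE ba).
Qed.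

(** The vector is p Omega normalised; it is nonzero because <p Omega, Omega> is the measure of the
    arc. *)
Lemma gns_arc_vector (d : R) : 0 < d -> exists2 v : H, `|v| = 1 &
  j i (arc_ind d) v = v.
Proof.
move=> d0; have rj := gns_rep hj i; have La := Linfty_circle_arc d.
have idem : j i (arc_ind d) \o j i (arc_ind d) = j i (arc_ind d).
  rewrite -(star_rep_mul rj La La); congr (j i _).
  by apply/funext => z; exact: arc_idem.
have [la _] := star_rep_bounded rj La.
pose u := j i (arc_ind d) Omega.
have u0 : u != 0.
  apply/eqP => u0; have := gns_state1 La; rewrite -/u u0 hdot0l.
  have [e e0 ->] := circle_int_arc d0.
  by move=> /toC_inj e0'; rewrite -e0' ltxx in e0.
exists (`|u|^-1 *: u); last by rewrite (linear_mapZ la); have /(congr1 (@^~ Omega)) /= -> := idem.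
by rewrite normrZ normfV normr_id mulVf // normr_eq0.
Qed.

End GNSVectors.

Lemma bounded_op_lin (R : realType) (H : hilbert R) (z : Cplx R) (S T : H -> H) :
  bounded_op S -> bounded_op T -> bounded_op (z *: S + T).
Proof.
move=> [lS cS] [lT cT]; split=> [c u v|x].
  change (z *: S (c *: u + v) + T (c *: u + v) =
    c *: (z *: S u + T u) + (z *: S v + T v)).
  rewrite lS lT !scalerDr !scalerA [z * c]mulrC -!addrA; congr (_ + _).
  by rewrite !addrA; congr (_ + _); rewrite addrC.
apply: cvgD; last exact: cT.
by apply: cvgZr; exact: cS.
Qed.

Lemma bounded_op0 (R : realType) (H : hilbert R) : @bounded_op R H 0.
Proof.
split=> [c u v|x]; last exact: cvg_cst.
by change (0 = c *: (0 : H) + 0); rewrite scaler0 addr0.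
Qed.

Lemma bounded_op_sum (R : realType) (H : hilbert R) n (c : 'I_n -> Cplx R)
    (T : 'I_n -> H -> H) : (forall k, bounded_op (T k)) ->
  bounded_op (\sum_(k < n) c k *: T k).
Proof.
elim: n c T => [|n IH] c T bT; first by rewrite big_ord0; exact: bounded_op0.
by rewrite big_ord_recl; apply: bounded_op_lin => //; exact: IH.
Qed.

(** Linearity of [kappa] is granted only between members of the closed span, so every partial sum
    must be placed there first; an element of the span approximates itself. *)
Lemma bounded_functional_sum (R : realType) (H : hilbert R) (S : set (H -> H))
    (kappa : (H -> H) -> Cplx R) n (c : 'I_n -> Cplx R) (T : 'I_n -> H -> H) :
  bounded_functional (sigma_wot_closure (lspan S)) kappa ->
  (forall k, S (T k) /\ bounded_op (T k)) ->
  sigma_wot_closure (lspan S) (\sum_(k < n) c k *: T k) /\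
  kappa (\sum_(k < n) c k *: T k) = \sum_(k < n) c k * kappa (T k).
Proof.
move=> [lk _].
have inA m (b : 'I_m -> Cplx R) (Y : 'I_m -> H -> H) :
    (forall k, S (Y k) /\ bounded_op (Y k)) ->
    sigma_wot_closure (lspan S) (\sum_(k < m) b k *: Y k).
  move=> SY; split; first by apply: bounded_op_sum => k; case: (SY k).
  move=> p omega e e0 _; exists (\sum_(k < m) b k *: Y k).
    by exists m, b, Y; split=> // k; case: (SY k).
  by move=> q; rewrite subrr normr0 -toC0 toC_lt.
have A0 : sigma_wot_closure (lspan S) 0.
  by have := @inA 0 (fun=> 0) (fun=> 0); rewrite big_ord0; apply; case.
have k0 : kappa 0 = 0.
  by have := lk (-1) 0 0 A0 A0; rewrite scaler0 addr0 mulN1r addNr.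
elim: n c T => [|n IH] c T ST; first by rewrite !big_ord0.
have [A1 k1] := IH (fun k => c (lift ord0 k)) (fun k => T (lift ord0 k)) (fun k => ST _).
have AT : sigma_wot_closure (lspan S) (T ord0).
  have := @inA 1 (fun=> 1) (fun=> T ord0) (fun=> ST _).
  by rewrite big_ord1 scale1r.
split; first exact: inA.
by rewrite !big_ord_recl lk // k1.
Qed.

Section ZeroElement.
Variables (R : realType) (X : Type) (A : set (X -> Cplx R)) (H : hilbert R).
Variable r : (X -> Cplx R) -> (H -> H).
Hypothesis hr : star_rep A r.
Hypothesis A0 : A (fun _ => 0).

Lemma star_rep_zero : r (fun _ => 0) = 0.
Proof.
have := star_rep_linear hr (-1) A0 A0; rewrite scaleN1r addNr => <-.
by congr r; apply/funext => x; rewrite mulr0 addr0.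
Qed.

Lemma star_rep_scale (z : Cplx R) f : A f -> r (fun x => z * f x) = z *: r f.
Proof.
move=> Af; rewrite -[RHS]addr0 -star_rep_zero -(star_rep_linear hr) //.
by congr r; apply/funext => x; rewrite addr0.
Qed.
End ZeroElement.

Section NormalHomZero.
Variables (R : realType) (H1 H2 : hilbert R) (M : set (H1 -> H1)).
Variable r : (H1 -> H1) -> (H2 -> H2).
Hypothesis hr : normal_star_hom M r.
Hypothesis M0 : M 0.

Lemma hom_zero : r 0 = 0.
Proof.
have := hom_linear hr (-1) M0 M0.
by rewrite scaler0 addr0 scaleN1r addNr.
Qed.

Lemma hom_scale (z : Cplx R) x : M x -> r (z *: x) = z *: r x.
Proof. by move=> Mx; rewrite -[LHS]/(r _) -[z *: x]addr0 (hom_linear hr) // hom_zero addr0. Qed.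
End NormalHomZero.

Section InfTensor.
Variables (R : realType) (I : choiceType) (H : hilbert R) (Omega : H).
Variable j : I -> (Cplx R -> Cplx R) -> (H -> H).
Hypothesis hj : product_state_gns Omega j.

Lemma inf_tensor_bounded : inf_tensor j `<=` @bounded_op R H.
Proof. by move=> T []. Qed.

Lemma inf_tensor_factor i f : Linfty_circle f -> inf_tensor j (j i f).
Proof.
move=> Lf; split; first exact: (star_rep_bounded (gns_rep hj i) Lf).
by move=> X [_ cX]; rewrite cX //; exists i, f.
Qed.

Lemma inf_tensor_id : inf_tensor j id.
Proof. by split; [exact: bounded_op_id|]. Qed.

Lemma Linfty_circle0 : Linfty_circle (fun _ : Cplx R => 0).
Proof.
by apply: (Linfty_circle_continuous (c := 0)) => t; [exact: cvg_cst|rewrite normr0].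
Qed.

Lemma gns_zero i : j i (fun _ => 0) = 0.
Proof. exact: (star_rep_zero (gns_rep hj i) Linfty_circle0). Qed.

Lemma inf_tensor0 (i : I) : inf_tensor j 0.
Proof. by rewrite -(gns_zero i); exact/inf_tensor_factor/Linfty_circle0. Qed.
End InfTensor.

(** Orthogonality of ranges, equality of norms and the projection property on K are all identities
    between two such sesquilinear forms, so elementary tensors suffice for each of them. *)
Lemma tens_hdot_eq (R : realType) (H K : hilbert R) (tens : H -> H -> K)
    (S T S' T' : K -> K) : hilbert_tensor tens ->
  bounded_op S -> bounded_op T -> bounded_op S' -> bounded_op T' ->
  (forall u v u' v', hdot (S (tens u v)) (T (tens u' v')) =
    hdot (S' (tens u v)) (T' (tens u' v'))) ->
  forall x y, hdot (S x) (T y) = hdot (S' x) (T' y).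
Proof.
move=> ht bS bT bS' bT' ST.
have lin (Y : K -> K) z : bounded_op Y ->
    linear (fun x => hdot (Y x) z : (Cplx R)^o) /\
    continuous (fun x => hdot (Y x) z : (Cplx R)^o).
  move=> [lY cY]; split=> [c u v|x]; first by rewrite lY hdotDl hdotZl.
  apply: (@continuous_comp _ _ _ Y (fun v : K => hdot v z)); first exact: cY.
  exact: hdot_continuousl.
have ST1 x u v : hdot (S x) (T (tens u v)) = hdot (S' x) (T' (tens u v)).
  have [l1 c1] := lin S (T (tens u v)) bS.
  have [l2 c2] := lin S' (T' (tens u v)) bS'.
  by move: x; apply: (tens_eq ht l1 c1 l2 c2) => u' v'; exact: ST.
move=> x y; rewrite hdotC [RHS]hdotC; congr (Num.conj _).
have [l1 c1] := lin T (S x) bT; have [l2 c2] := lin T' (S' x) bT'.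
move: y; apply: (tens_eq ht l1 c1 l2 c2) => u v.
by rewrite hdotC ST1 -hdotC.
Qed.

(** * The braided product *)

Section Covariance.
Variables (R : realType) (H1 H : hilbert R) (M : set (H1 -> H1)).
Variables (alpha : R -> (H1 -> H1) -> (H1 -> H1)) (r : (H1 -> H1) -> (H -> H)).
Variables (phi : (R -> Cplx R) -> (H -> H)) (U : R -> H -> H).
Hypothesis nphi : nondegenerate_rep phi.
Hypothesis rU : rep_of_C0 phi U.
Hypothesis himpl : implements M alpha r U.
Hypothesis M1 : M id.

Let rphi : star_rep (@C0 R R) phi := nphi.1.
Let dphi := nondegenerate_range_determining nphi.

(** [implements] at m = id supplies some adjoint of U_x; on the range of [phi] it multiplies by the
    conjugate character, as U_(-x) does. *)
Lemma implementing_adjoint x : is_adjoint (U x) (U (- x)).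
Proof.
have [V [bV aV] _] := himpl x M1; suff VU v : V v = U (- x) v.
  by move=> u v; rewrite aV VU.
have [lV cV] := bV; have [lU cU] := (rU (- x)).1.
move: v; apply: (dphi lV cV lU cU) => f v Cf.
rewrite (multiplier_value_adjoint rphi dphi v (rU x) (bcf_pairing x) aV Cf).
rewrite (multiplier_value_range v (rU (- x)) Cf).
congr (phi _ v); apply/funext => xi; congr (_ * _).
by rewrite conjCK /pairing mulrN expiN conjCK.
Qed.

Lemma implementing_unitary x :
  (forall v, U (- x) (U x v) = v) /\ (forall v, U x (U (- x) v) = v).
Proof.
apply: (multiplier_value_unitary rphi dphi (rU x) (bcf_pairing x) (rU (- x)).1).
  exact: implementing_adjoint.
by move=> xi; rewrite conjCK mulrC expiJM.
Qed.

Lemma implementing_dot x u v : hdot (U x u) (U x v) = hdot u v.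
Proof. by rewrite implementing_adjoint (implementing_unitary x).1. Qed.

Lemma implementing_covariance x m v : M m ->
  r (alpha x m) v = U (- x) (r m (U x v)).
Proof.
move=> Mm; have [V [bV aV] ->] := himpl x Mm.
exact: is_adjoint_unique aV (implementing_adjoint x) _.
Qed.
End Covariance.

Section RotatedArcs.
Variable R : realType.
Implicit Types (x y d t : R).

Lemma rotate_arc_expi x d t :
  rotate x (arc_ind d) (expi t) = arc_ind d (expi (t + x)).
Proof. by rewrite /rotate -expiD. Qed.

Lemma Linfty_circle_rotate_arc x d : Linfty_circle (rotate x (arc_ind d)).
Proof.
split.
- have -> : (fun t => Rpart (rotate x (arc_ind d) (expi t))) =
      (\1_(arc_set d) : R -> R) \o (fun t => t + x).
    by rewrite -Rpart_arc; apply/funext => t; rewrite rotate_arc_expi.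
  apply: measurableT_comp.
    by apply: measurable_realfun.measurable_indic; exact: measurable_arc_set.
  apply: measurable_realfun.continuous_measurable_fun => t.
  by apply: cvgD; [exact: cvg_id|exact: cvg_cst].
- exact: measurable_cst.
- exists 1; apply: aeW => t; rewrite norm_toC toC_le normr_nat.
  by case: (_ < _).
Qed.

Lemma rotate_arc_disjoint x y d t : 4 * d <= 1 - cos (2 * pi * (x - y)) ->
  rotate x (arc_ind d) (expi t) * rotate y (arc_ind d) (expi t) = 0.
Proof.
move=> dxy; rewrite !rotate_arc_expi /arc_ind /=.
case: (boolP (1 - d < cos (2 * pi * (t + x)))) => hx; last by rewrite -toCM mul0r.
case: (boolP (1 - d < cos (2 * pi * (t + y)))) => hy; last by rewrite -toCM mulr0.
by have := cos_arc_disjoint hx hy; rewrite ltNge dxy.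
Qed.
End RotatedArcs.

Section BraidedNorm.
Variables (R : realType) (I : choiceType) (i : I) (a : R).
Variables (H0 : hilbert R) (Omega : H0).
Variable j : I -> (Cplx R -> Cplx R) -> (H0 -> H0).
Hypothesis hj : product_state_gns Omega j.
Variable alpha : R -> (H0 -> H0) -> (H0 -> H0).
Hypothesis halpha : diagonal_action j alpha.
Variables (H : hilbert R) (r : (H0 -> H0) -> (H -> H)).
Hypothesis hr : normal_star_hom (inf_tensor j) r.
Variable phi : (R -> Cplx R) -> (H -> H).
Hypothesis nphi : nondegenerate_rep phi.
Variable U : R -> H -> H.
Hypothesis rU : rep_of_C0 phi U.
Hypothesis himpl : implements (inf_tensor j) alpha r U.
Variables (K : hilbert R) (tens : H -> H -> K).
Hypothesis htens : hilbert_tensor tens.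
Variable phi2 : (R * R -> Cplx R) -> (K -> K).
Hypothesis tphi2 : tensor_rep tens phi phi2.
Variable Rop : K -> K.
Hypothesis hRop : multiplier_value phi2 (Rhat a) Rop.
Variables iota1 iota2 : (H0 -> H0) -> (K -> K).
Hypothesis hiota : braided_embeddings (inf_tensor j) r tens Rop iota1 iota2.

Let M := inf_tensor j.
Let M1 : M id := inf_tensor_id j.
Let Mf f : Linfty_circle f -> M (j i f) := @inf_tensor_factor _ _ _ _ _ hj i f.
Let rj := gns_rep hj i.
Let w k : H -> H := r (j i (mono k)).

Lemma alpha_mono x k :
  r (alpha x (j i (mono k))) = expi (k%:R * x) *: w k.
Proof.
have Lk := Linfty_circle_mono R k.
rewrite halpha.2 //.
have -> : rotate x (mono k) = (fun z => expi (k%:R * x) * mono k z).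
  by apply/funext => z; rewrite /rotate /mono exprMn expiX mulrC [_ * x]mulrC.
rewrite (star_rep_scale rj) //; last exact: Linfty_circle0.
by rewrite (hom_scale hr) //; [exact: (inf_tensor0 hj i)|exact: Mf].
Qed.

(** Rotation by x multiplies u^k by e^(2 pi i k x); covariance turns this into the hypothesis [Uw]
    of the intertwining sections, with c = k. *)
Lemma implementing_mono x k v :
  U x (w k v) = expi (- (k%:R * x)) *: w k (U x v).
Proof.
have [lU _] := (rU x).1.
have e := implementing_covariance nphi rU himpl M1 x v (Mf (Linfty_circle_mono R k)).
rewrite alpha_mono in e.
have := congr1 (U x) e; rewrite (implementing_unitary nphi rU himpl M1 x).2.
rewrite -[(_ *: w k) v]/(_ *: w k v) (linear_mapZ lU) -/(w k) => <-.
by rewrite scalerA expiN expiJM scale1r.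
Qed.

(** The product of z^k and its conjugate is 1 on the circle only, not on the plane, so [gns_ae] is
    applied before unitality. *)
Lemma mono_isometry k u v : hdot (w k u) (w k v) = hdot u v.
Proof.
have Lk := Linfty_circle_mono R k; have Lc := Linfty_circle_conj Lk.
have ad := hom_adj hr (Mf Lk) (Mf Lc) (star_rep_adj rj Lk).
rewrite /w ad; congr (hdot u _).
have := hom_mul hr (Mf Lc) (Mf Lk); rewrite -(star_rep_mul rj Lc Lk).
rewrite (gns_ae hj i (g := fun _ => 1)).
- by rewrite (gns_unital hj) (hom_unital hr) => /(congr1 (@^~ v)) /= <-.
- by apply: (Linfty_circle_expi (m := 0)) => t;
    rewrite conj_expi_mono /mono expiX -expiD mulr0; congr expi; ring.
- by apply: (Linfty_circle_expi (m := 0)) => t; rewrite mulr0 expi0.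
- by apply: aeW => t; rewrite conj_expi_mono /mono expiX -expiD addNr expi0.
Qed.

Variables (n : nat) (d : R).
Hypothesis gap : forall k, (0 < k < n)%N -> 4 * d <= 1 - cos (2 * pi * (k%:R * a)).

Let p := j i (arc_ind d).
Let P := r p.
Let Mp : M p := Mf (Linfty_circle_arc d).

(** The projection of the rotated arc: U_(-ka) P = q_k U_(-ka), so the second leg of [E k] has its
    range in that of q_k. *)
Let q k := r (alpha (k%:R * a) p).
Let Mq k : M (alpha (k%:R * a) p).
Proof. exact: (action_stable halpha.1). Qed.

Lemma arc_self_adjoint : is_adjoint p p.
Proof.
have := star_rep_adj rj (Linfty_circle_arc d).
by rewrite (_ : (fun z => _) = arc_ind d) //; apply/funext => z; exact: arc_conj.
Qed.

Lemma rotated_arc_self_adjoint k : is_adjoint (q k) (q k).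
Proof.
apply: (hom_adj hr (Mq k) (Mq k)).
exact: (hom_adj (action_hom halpha.1 (k%:R * a)) Mp Mp arc_self_adjoint).
Qed.

Lemma rotated_arc_orthogonal k l v : (k < n)%N -> (l < n)%N -> k != l ->
  q k (q l v) = 0.
Proof.
move=> kn ln kl.
(* [gap] speaks of positive multiples of a; for k < l the evenness of cos is used. *)
have klgap : 4 * d <= 1 - cos (2 * pi * (k%:R * a - l%:R * a)).
  rewrite -mulrBl; have [lk|kl'] := leqP l k.
    by rewrite -natrB //; apply: gap; rewrite subn_gt0 ltn_neqAle eq_sym kl lk
      (leq_ltn_trans (leq_subr _ _)).
  rewrite -cosN -mulrN -mulNr opprB -natrB; last exact: ltnW.
  by apply: gap; rewrite subn_gt0 kl' (leq_ltn_trans (leq_subr _ _)).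
rewrite /q -[LHS]/((r _ \o r _) v) -(hom_mul hr (Mq k) (Mq l)).
rewrite !halpha.2; try exact: Linfty_circle_arc.
have Lr x := Linfty_circle_rotate_arc x d.
rewrite -(star_rep_mul rj) // (gns_ae hj i (g := fun _ => 0)).
- by rewrite (gns_zero hj) (hom_zero hr) //; exact: (inf_tensor0 hj i).
- apply: (Linfty_circle_continuous (c := 0)) => [|t].
    rewrite (_ : (fun t => _) = (fun _ => 0)); first by move=> t; exact: cvg_cst.
    by apply/funext => t; exact: rotate_arc_disjoint.
  by rewrite rotate_arc_disjoint // normr0.
- exact: Linfty_circle0.
- by apply: aeW => t; exact: rotate_arc_disjoint.
Qed.

Lemma arc_projection u v : hdot (P u) (P v) = hdot (P u) v.
Proof.
have aP : is_adjoint P P := hom_adj hr Mp Mp arc_self_adjoint.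
rewrite -aP; congr (hdot _ v).
have := hom_mul hr Mp Mp; rewrite -(star_rep_mul rj) //; try exact: Linfty_circle_arc.
rewrite (_ : (fun z => _) = arc_ind d); first by move=> /(congr1 (@^~ u)).
by apply/funext => z; exact: arc_idem.
Qed.

Let E k := iota1 (j i (mono k)) \o iota2 p.

Lemma braided_word_bounded k : bounded_op (E k).
Proof.
have [X [Rst [[bX _] [bRst _] iE]]] := braided_left hiota (Mf (Linfty_circle_mono R k)).
have [b2 _] := braided_right hiota Mp; rewrite /E iE.
exact: bounded_op_comp (bounded_op_comp (bounded_op_comp hRop.1 bX) bRst) b2.
Qed.

Lemma braided_word_tens k u v :
  E k (tens u v) = tens (w k u) (U (- (k%:R * a)) (P v)).
Proof.
have [X [Rst [tX [bRst aRst] iE]]] := braided_left hiota (Mf (Linfty_circle_mono R k)).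
have [_ t2] := braided_right hiota Mp.
rewrite /E /= t2 iE /=.
apply: (braided_left_tens htens nphi tphi2 tX rU _ hRop bRst aRst).
  by move=> x y; exact: implementing_mono.
exact: hom_bounded hr _ (Mf (Linfty_circle_mono R k)).
Qed.

Lemma implementing_arc k v : U (- (k%:R * a)) (P v) = q k (U (- (k%:R * a)) v).
Proof.
rewrite /q (implementing_covariance nphi rU himpl M1) //.
by rewrite (implementing_unitary nphi rU himpl M1 _).2.
Qed.

(** On elementary tensors the second legs give <q_k v, q_l v'> = <v, q_k q_l v'> = 0. *)
Lemma braided_word_orthogonal k l x y : (k < n)%N -> (l < n)%N -> k != l ->
  hdot (E k x) (E l y) = 0.
Proof.
move=> kn ln kl; rewrite -[RHS](hdot0l (0 : K)).
apply: (tens_hdot_eq (S' := 0) (T' := 0) htens); try exact: braided_word_bounded;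
  try exact: bounded_op0.
move=> u v u' v'; rewrite !braided_word_tens htens.1 [RHS]hdot0l.
rewrite !implementing_arc rotated_arc_self_adjoint.
by rewrite rotated_arc_orthogonal // hdot0r mulr0.
Qed.

(** Both w_k and U_(-ka) preserve inner products, which leaves only the contribution of P, the same
    for all k. *)
Lemma braided_word_dot k x : hdot (E k x) (E k x) = hdot (iota2 p x) (iota2 p x).
Proof.
have [b2 t2] := braided_right hiota Mp.
apply: (tens_hdot_eq htens) => //; try exact: braided_word_bounded.
move=> u v u' v'; rewrite !braided_word_tens !t2 !htens.1 mono_isometry.
by rewrite (implementing_dot nphi rU himpl M1).
Qed.

(** [iota2 p] is a projection, so |iota2(p) x|^2 = <iota2(p) x, x>, and Cauchy-Schwarz cancels one
    factor. *)
Lemma braided_arc_contraction x : `|iota2 p x| <= `|x|.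
Proof.
have [b2 t2] := braided_right hiota Mp.
have e : hdot (iota2 p x) (iota2 p x) = hdot (iota2 p x) (id x).
  apply: (tens_hdot_eq htens) => //; first exact: bounded_op_id.
  by move=> u v u' v'; rewrite !t2 !htens.1 arc_projection.
have := Cauchy_Schwarz (iota2 p x) x; rewrite -e -hdotE normrX normr_id expr2.
have [->|x0] := eqVneq (iota2 p x) 0; first by rewrite normr0.
by rewrite ler_pM2l // normr_gt0.
Qed.

(** Pythagoras: the squared norm of the sum is c^2 n |iota2(p) x|^2. *)
Lemma braided_sum_contraction (c : R) x : c ^+ 2 * n%:R <= 1 ->
  `|\sum_(k < n) toC c *: E k x| <= `|x|.
Proof.
move=> cn; apply: le_trans (braided_arc_contraction x).
rewrite -(ler_pXn2r (n := 2)) ?nnegrE // !hdotE hdot_suml.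
rewrite (eq_bigr (fun=> toC (c ^+ 2) * hdot (iota2 p x) (iota2 p x))); last first.
  move=> k _; rewrite hdot_sumr (bigD1 k) //= big1 ?addr0 => [|l lk].
    by rewrite hdotZl hdotZr conj_toC mulrA -toCM -expr2 braided_word_dot.
  by rewrite hdotZl hdotZr braided_word_orthogonal ?mulr0 // eq_sym.
rewrite sumr_const card_ord -mulrnAl -hdotE.
apply: ler_piMl; first exact: exprn_ge0.
by rewrite -mulr_natr -(toC_nat R) -toCM -toC1 toC_le.
Qed.
End BraidedNorm.

Theorem proposition8p3 (R : realType) (a : R) (ha : irrational a)
  (* M = \bar\otimes_{n <= -1} (L^oo(T), \int_T), acting on H0 *)
  (H0 : hilbert R) (Omega : H0)
  (j : {n : int | n < 0} -> (Cplx R -> Cplx R) -> (H0 -> H0))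
  (hj : product_state_gns Omega j)
  (alpha : R -> (H0 -> H0) -> (H0 -> H0))
  (halpha : diagonal_action j alpha)
  (* the representation of M on H_M and the implementation of the action *)
  (HM : hilbert R) (r : (H0 -> H0) -> (HM -> HM))
  (hr : faithful_normal_rep (inf_tensor j) r)
  (phi : (R -> Cplx R) -> (HM -> HM)) (hphi : nondegenerate_rep phi)
  (U : R -> HM -> HM) (hU : rep_of_C0 phi U)
  (himpl : implements (inf_tensor j) alpha r U)
  (* H_M (x) H_M and Rop = (phi (x) phi)(Rhat a) *)
  (HH : hilbert R) (tens : HM -> HM -> HH) (htens : hilbert_tensor tens)
  (phi2 : (R * R -> Cplx R) -> (HH -> HH)) (hphi2 : tensor_rep tens phi phi2)
  (Rop : HH -> HH) (hRop : multiplier_value phi2 (Rhat a) Rop)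
  (iota1 iota2 : (H0 -> H0) -> (HH -> HH))
  (hiota : braided_embeddings (inf_tensor j) r tens Rop iota1 iota2) :
  exists rho nu : (H0 -> H0) -> Cplx R,
    [/\ normal_functional (inf_tensor j) rho,
        normal_functional (inf_tensor j) nu &
        ~ exists2 kappa : (HH -> HH) -> Cplx R,
            bounded_functional
              (braided_product (inf_tensor j) iota1 iota2) kappa &
            forall x y, inf_tensor j x -> inf_tensor j y ->
              kappa (iota1 x \o iota2 y) = rho x * nu y].
Proof.
pose i : {n : int | n < 0} := exist _ (-1 : int) isT.
(* A square, so that N^(-1/2) = 32^(-n) needs no root. The factor 4 * 4 of 32 pays for the weights
   of rho and nu, the remaining 2 gives growth. *)
pose N n := ((32 ^ n) ^ 2)%N.
have N0 n : (0 < N n)%N by rewrite !expn_gt0.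
have NN0 n : (0 < N n + N n)%N by rewrite addn_gt0 N0.
have gapP n : exists d : R, 0 < d /\ forall k, (0 < k < N n)%N ->
    4 * d <= 1 - cos (2 * pi * (k%:R * a)).
  by have [d d0 dk] := irrational_gap (N n) ha; exists d.
have [d dP] := choice gapP.
have xiP n : exists v : H0, `|v| = 1 /\
    forall k, hdot (j i (mono k) v) v = toC (fejer_coef R k (N n + N n)).
  by have [v v1 vk] := gns_fejer_vector hj i (NN0 n); exists v.
have [xi xiE] := choice xiP.
have etaP n : exists v : H0, `|v| = 1 /\ j i (arc_ind (d n)) v = v.
  by have [v v1 vd] := gns_arc_vector hj i (dP n).1; exists v.
have [eta etaE] := choice etaP.
have Mb := @inf_tensor_bounded R _ H0 j.
have Mf f : Linfty_circle f -> inf_tensor j (j i f) := @inf_tensor_factor _ _ _ _ _ hj i f.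
have [rho nrho rhoE] := geometric_normal_functional Mb (fun n => (xiE n).1).
have [nu nnu nuE] := geometric_normal_functional Mb (fun n => (etaE n).1).
exists rho, nu; split=> // -[kappa bk kE].
have rhok n k : (k < N n)%N ->
    exists2 s, rho (j i (mono k)) = toC s & 4^-1 ^+ n * 2^-1 <= s.
  move=> kN.
  have [s sE sn] := rhoE _ _ (Mf _ (Linfty_circle_mono R k)) (fun m => (xiE m).2 k)
    (fun m => fejer_coef_ge0 _ _ _).
  exists s => //; apply: le_trans (sn n).
  by rewrite ler_wpM2l ?exprn_ge0 ?invr_ge0 // fejer_coef_ge.
have nun n : exists2 s, nu (j i (arc_ind (d n))) = toC s & 4^-1 ^+ n <= s.
  have La := Linfty_circle_arc (d n); have rj := gns_rep hj i.
  set p := j i (arc_ind (d n)).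
  (* For m other than n nothing is known about p_n eta_m; being a projection, p_n still contributes
     a nonnegative term there, and the term m = n is exactly 4^(-n). *)
  have pdot v : hdot (p v) v = `|p v| ^+ 2.
    rewrite hdotE -(arc_self_adjoint i hj) -/p; congr (hdot _ v).
    rewrite -[RHS]/((p \o p) v) /p -(star_rep_mul rj La La).
    by congr (j i _ v); apply/funext => z; rewrite arc_idem.
  have p0 m : 0 <= `|p (eta m)| ^+ 2 by exact: exprn_ge0.
  have [|m|s sE sn] := nuE p (fun m => Rpart (`|p (eta m)| ^+ 2)) (Mf _ La).
  - by move=> m; rewrite pdot -ge0_toC.
  - by rewrite -toC_le -ge0_toC.
  exists s => //; have := sn n.
  by rewrite /p (etaE n).2 (etaE n).1 expr1n /= mulr1.
have [_ [c kc]] := bk.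
have key n : 2 ^+ n / 2 <= c.
  pose e : R := 32^-1 ^+ n; have e0 : 0 < e by rewrite exprn_gt0 // invr_gt0.
  have eN : e ^+ 2 * (N n)%:R = 1.
    by rewrite /N natrX -exprMn natrX -exprMn mulVf ?expr1n.
  have La := Linfty_circle_arc (d n).
  pose p := j i (arc_ind (d n)).
  pose T (k : 'I_(N n)) := iota1 (j i (mono k)) \o iota2 p.
  have Tb k : bounded_op (T k).
    exact: (braided_word_bounded i hj hRop hiota).
  have [AT kT] := bounded_functional_sum (fun=> toC e) bk
    (fun k => conj (ex_intro _ _ (ex_intro _ _
       (And3 (Mf _ (Linfty_circle_mono R k)) (Mf _ La) (erefl (T k))))) (Tb k)).
  have [s sE s4] := nun n.
  have Tn v : `|(\sum_(k < N n) toC e *: T k) v| <= toC 1 * `|v|.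
    have := braided_sum_contraction i hj halpha hr.1 hphi hU himpl htens hphi2 hRop
      hiota (dP n).2 v (c := e).
    rewrite eN mul1r => /(_ (lexx 1)); congr (`|_| <= _).
    by rewrite fct_sumE.
  have := kc _ 1 AT Tn; rewrite kT mulr1.
  have -> : \sum_(k < N n) toC e * kappa (T k) =
      toC (\sum_(k < N n) e * (Rpart (rho (j i (mono k))) * s)).
    rewrite (big_morph (@toC R) (@toCD R) (@toC0 R)); apply: eq_bigr => k _.
    rewrite kE; [|exact/Mf/Linfty_circle_mono|exact: Mf].
    by rewrite sE; have [t -> _] := rhok n k (ltn_ord k); rewrite -!toCM.
  rewrite norm_toC toC_le => /(le_trans (ler_norm _)); apply: le_trans.
  apply: (@le_trans _ _ (\sum_(k < N n) e * (4^-1 ^+ n * 2^-1 * 4^-1 ^+ n))); last first.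
    apply: ler_sum => k _; rewrite ler_wpM2l ?(ltW e0) //.
    have [t -> t4] := rhok n k (ltn_ord k).
    by apply: ler_pM; rewrite // ?mulr_ge0 ?exprn_ge0 ?invr_ge0.
  rewrite sumr_const card_ord -[X in _ <= X]mulr_natr le_eqVlt; apply/orP; left; apply/eqP.
  have -> : (N n)%:R = 32 ^+ n * 32 ^+ n :> R by rewrite /N natrX natrX expr2.
  rewrite /e; have -> : (2 : R) ^+ n = (32^-1 * (4^-1 * 4^-1) * (32 * 32)) ^+ n.
    by congr (_ ^+ n); field.
  by rewrite !exprMn; ring.
(* With m = trunc(2c) + 1 one has 2c < m < 2^m, against 2^m / 2 <= c. *)
have := key (Num.trunc (2 * c)).+1; apply/negP; rewrite -ltNge ltr_pdivlMr //.
rewrite mulrC (lt_trans (truncnS_gt _)) // -natrX ltr_nat.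
exact: ltn_expl.
Qed.
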